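(* Let $L$ be a Lelek fan with top $v$, and let $\mathcal L(L)$ be the set of legs of $L$. Then for each leg $A\in\mathcal L(L)$ there is a Cantor fan $C_A\subseteq L$ such that: - for all $A_1,A_2\in\mathcal L(L)$ with $A_1\neq A_2$ we have $C_{A_1}\cap C_{A_2}=\{v\}$; - $\bigcup_{A\in\mathcal L(L)}C_A=L$.
   Context: A continuum is a nonempty compact connected metric space. A dendroid is an arcwise connected, hereditarily unicoherent continuum. A point $x$ of a dendroid $X$ is a ramification point if $x$ is the top (the branch point) of some simple triod in $X$. A fan is a dendroid with at most one ramification point; this point, if it exists, is called the top of the fan. For a fan $X$, a point $x$ is an end point of $X$ if $x$ is an end point of every arc in $X$ containing $x$; $E(X)$ denotes the set of end points of $X$. For a fan $X$ with top $v$, a leg of $X$ is the arc from $v$ to an end point $e\in E(X)$, and $\mathcal L(X)$ denotes the set of legs. A fan $X$ with top $v$ is smooth if for every $x\in X$ and every sequence $x_n\to x$ in $X$, the arcs from $v$ to $x_n$ converge (in the Hausdorff metric) to the arc from $v$ to $x$. A Lelek fan is a smooth fan $X$ with $\mathrm{Cl}(E(X))=X$. A Cantor fan is a continuum homeomorphic to $\bigcup_{c\in C}A_c\subseteq\mathbb R^2$, where $C\subseteq[0,1]$ is the Cantor middle-third set and $A_c$ is the straight segment from $(\tfrac12,0)$ to $(c,1)$. *)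

(* Defs.v *)
From HB Require Import structures.
From mathcomp Require Import all_boot all_order all_algebra.
From mathcomp Require Import all_classical all_reals all_analysis.
Set Implicit Arguments. Unset Strict Implicit. Unset Printing Implicit Defensive.
Import Order.TTheory GRing.Theory Num.Theory.
Import numFieldNormedType.Exports.
Local Open Scope classical_set_scope.
Local Open Scope ring_scope.

Section Defs.
Variable R : realType.

Definition homeo_sets {X Y : topologicalType} (S : set X) (U : set Y)
    (f : X -> Y) (g : Y -> X) : Prop :=
  [/\ {within S, continuous f}, {within U, continuous g},
      (forall x, S x -> U (f x) /\ g (f x) = x) &
      (forall y, U y -> S (g y) /\ f (g y) = y)].

Definition homeomorphic {X Y : topologicalType} (S : set X) (U : set Y) :=
  exists f g, homeo_sets S U f g.

Variable X : pseudoMetricType R.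

Definition arc_ends (A : set X) (a b : X) : Prop :=
  exists (f : R -> X) (g : X -> R),
    homeo_sets (`[0, 1] : set R) A f g /\ f 0 = a /\ f 1 = b.

Definition is_arc (A : set X) : Prop := exists a b, arc_ends A a b.

(** continuum: nonempty compact connected (the ambient space is a metric space) *)
Definition continuum (K : set X) : Prop :=
  [/\ K !=set0, compact K & connected K].

Definition arcwise_connected (L : set X) : Prop :=
  forall x y, L x -> L y -> x <> y -> exists A, A `<=` L /\ arc_ends A x y.

Definition hereditarily_unicoherent (L : set X) : Prop :=
  forall P Q, P `<=` L -> Q `<=` L -> continuum P -> continuum Q ->
    connected (P `&` Q).

Definition dendroid (L : set X) : Prop :=
  [/\ continuum L, arcwise_connected L & hereditarily_unicoherent L].

Definition simple_triod_top (T : set X) (v : X) : Prop :=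
  exists (A1 A2 A3 : set X) (e1 e2 e3 : X),
    [/\ arc_ends A1 v e1, arc_ends A2 v e2, arc_ends A3 v e3,
        [/\ A1 `&` A2 = [set v], A1 `&` A3 = [set v] & A2 `&` A3 = [set v]]
      & T = A1 `|` A2 `|` A3].

Definition ramification_point (L : set X) (x : X) : Prop :=
  exists T, T `<=` L /\ simple_triod_top T x.

Definition fan (L : set X) : Prop :=
  dendroid L /\
  (forall x y, ramification_point L x -> ramification_point L y -> x = y).

Definition fan_with_top (L : set X) (v : X) : Prop :=
  fan L /\ L v /\ ramification_point L v.

Definition end_point (L : set X) (x : X) : Prop :=
  L x /\
  forall A a b, A `<=` L -> arc_ends A a b -> A x -> x = a \/ x = b.

Definition arc_in_from (L : set X) (v x : X) (A : set X) : Prop :=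
  (x = v /\ A = [set v]) \/ (A `<=` L /\ arc_ends A v x).

Definition eps_nbhd (S : set X) (e : R) : set X :=
  [set y | exists2 z, S z & ball z e y].

Definition hausdorff_cvg (A : nat -> set X) (B : set X) : Prop :=
  forall e : R, 0 < e -> exists N, forall n, (N <= n)%N ->
    A n `<=` eps_nbhd B e /\ B `<=` eps_nbhd (A n) e.

Definition smooth_fan (L : set X) (v : X) : Prop :=
  fan_with_top L v /\
  forall (x : X) (u : nat -> X) (A : nat -> set X) (B : set X),
    L x -> (forall n, L (u n)) -> u @ \oo --> x ->
    (forall n, arc_in_from L v (u n) (A n)) -> arc_in_from L v x B ->
    hausdorff_cvg A B.

Definition lelek_fan (L : set X) (v : X) : Prop :=
  smooth_fan L v /\ closure (end_point L) = L.

Definition legs (L : set X) (v : X) : set (set X) :=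
  [set A | exists e, end_point L e /\ A `<=` L /\ arc_ends A v e].

End Defs.

Definition cantor_middle_third (R : realType) : set R :=
  [set x | exists a : nat -> bool,
     (series (fun k => (a k)%:R * 2 / 3 ^+ k.+1 : R)) @ \oo --> x].

(** The standard Cantor fan: union of segments from (1/2,0) to (c,1), c in C. *)
Definition std_cantor_fan (R : realType) : set (R * R)%type :=
  [set p | exists c t, @cantor_middle_third R c /\ 0 <= t <= 1 /\
     p = ((1 - t) * 2^-1 + t * c, t)].

Definition cantor_fan (R : realType) (X : pseudoMetricType R) (S : set X) :=
  homeomorphic S (@std_cantor_fan R).

(* Main.v *)
Require Import Defs.
From HB Require Import structures.
From mathcomp Require Import all_boot all_order all_algebra.
From mathcomp Require Import all_classical all_reals all_analysis.
From mathcomp Require Import zify lra.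
Set Implicit Arguments.
Unset Strict Implicit.
Unset Printing Implicit Defensive.
Import Order.TTheory GRing.Theory Num.Theory.
Import numFieldNormedType.Exports.
Local Open Scope classical_set_scope.
Local Open Scope ring_scope.

(** In a Lelek fan every point lies below an end point for the order
    "[x] is on the arc from [v] to [y]", and the legs meet only at [v]; so a
    union of legs whose end points form a Cantor set is a Cantor fan, as one sees
    by normalising a strictly increasing continuous height on each leg. Hence it
    suffices to partition the set [E] of end points into as many Cantor sets as
    there are legs. [E] is a dense G_delta set with empty interior, so one can
    place pairwise disjoint Cantor sets in the members of a countable base, and
    split each of them into continuum many Cantor sets. An end point [r] that
    is missed is added as the limit of a sequence of such small pieces; as end
    points are coded by bit sequences, different [r] can use different pieces,
    and continuum many pieces are left over. Cantor-Bernstein then matches the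
    resulting pieces with the legs. *)

(** * Compact pseudometric spaces *)

Section CompactPseudometric.
Context {R : realType} (T : pseudoMetricType R).

(** The Cantor fan assigned to a leg need not contain that leg; this is why an arbitrary bijection
    between pieces and legs is good enough. The obstacle is that countably many Cantor sets may miss
    uncountably many end points, and a missed point is not a piece by itself. It needs small Cantor
    sets at every scale around it, and many missed points compete for parts of the same set; hence
    each set is cut into continuum many slices, and a missed point takes the slices labelled by its
    own code. That [E] is a dense G_delta feeds a Cantor scheme inside any open set. That [E] has
    empty interior leaves room: finitely many Cantor sets in [E] form a closed subset of [E], so
    they never fill a member of the base. Of the fan only the properties in [lelek_order] are used,
    on the subtype of [L], where the fan is the whole compact space. The height is a Whitney-type
    sum, built on the same ternary series that parametrizes the Cantor set of the standard fan. *)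

Lemma compact_finite_net (e : R) : compact [set: T] -> 0 < e ->
  exists s : seq T, forall x, exists2 y, y \in s & ball y e x.
Proof.
move=> cT e0; apply: contrapT => nex.
(* A cluster point [p] of this filter gives the contradiction: the list [[:: p]] yields a member of
   the filter disjoint from the ball around [p]. *)
pose F := filter_from [set: seq T]
  (fun s => [set x | forall y, y \in s -> ~ ball y e x]).
have FF : ProperFilter F.
  apply: filter_from_proper.
    apply: filter_from_filter; first by exists [::].
    move=> s t _ _; exists (s ++ t) => // x xst.
    by split=> y ys; apply: xst; rewrite mem_cat ys ?orbT.
  move=> s _; apply: contrapT => s0; apply: nex; exists s => x.
  apply: contrapT => xs; apply: s0; exists x => y ys yx.
  by apply: xs; exists y.
have [p [_ /(_ [set x | ~ ball p e x] (ball p e))]] := cT F FF filterT.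
case.
- by exists [:: p] => // x; apply; rewrite inE.
- exact: nbhsx_ballx.
- by move=> x [].
Qed.

Lemma compact_dense_seq (v : T) : compact [set: T] ->
  exists q : nat -> T, forall x e, 0 < e -> exists n, ball (q n) e x.
Proof.
move=> cT.
have net (j : nat) : {s : seq T |
    forall x, exists2 y, y \in s & ball y j.+1%:R^-1 x}.
  by apply/cid/compact_finite_net => //; rewrite invr_gt0.
(* The pair [(j, i)] codes the [i]-th point of the [j]-th net; [v] fills the numbers that code no
   pair. *)
exists (fun m => if unpickle m is Some ji then nth v (sval (net ji.1)) ji.2
                 else v) => x e e0.
have [k _ /ltW ke] : exists2 k : nat, True & k.+1%:R^-1 < e.
  have [k _ /(_ _ (leqnn _)) hk] := near_infty_natSinv_lt (PosNum e0).
  by exists k.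
have [y ys yx] := svalP (net k) x.
exists (pickle (k, index y (sval (net k)))).
by rewrite pickleK /= nth_index //; exact: le_ball yx.
Qed.

(** This is [max(0, 1 - d(q, z))] with the distance [d] expressed through balls; the extra element
    [e = 1] contributes the value 0 and keeps the set nonempty. *)
Definition bump (q z : T) : R :=
  sup [set 1 - e | e in [set e | e = 1 \/ (0 < e <= 1 /\ ball q e z)]].

Let bump_has_sup (q z : T) :
  has_sup [set 1 - e | e in [set e : R | e = 1 \/ (0 < e <= 1 /\ ball q e z)]].
Proof.
split; first by exists 0; exists 1; [left|rewrite subrr].
by exists 1 => _ [e [->|[/andP[e0 e1] _]] <-]; lra.
Qed.

Lemma bump_ge0 q z : 0 <= bump q z.
Proof.
apply: ub_le_sup; first by case: (bump_has_sup q z).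
by exists 1; [left|rewrite subrr].
Qed.

Lemma bump_le1 q z : bump q z <= 1.
Proof.
apply: ge_sup; first by case: (bump_has_sup q z).
by move=> _ [e [->|[/andP[e0 e1] _]] <-]; lra.
Qed.

Lemma bump_ball q e z : 0 < e <= 1 -> ball q e z -> 1 - e <= bump q z.
Proof.
move=> e01 qz; apply: ub_le_sup; first by case: (bump_has_sup q z).
by exists e => //; right.
Qed.

Lemma ball_bump q e z : e <= 1 -> 1 - e < bump q z -> ball q e z.
Proof.
move=> e1 /(sup_gt (proj1 (bump_has_sup q z)))[_ [d [->|[/andP[d0 d1] qz]] <-]].
  by rewrite ltrD2l ltrN2 ltNge e1.
by rewrite ltrD2l ltrN2 => /ltW/le_ball; exact.
Qed.

Lemma bump_lipschitz q z z' e : 0 < e -> ball z e z' -> bump q z - e <= bump q z'.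
Proof.
move=> e0 zz'; rewrite lerBlDr; apply: ge_sup; first by case: (bump_has_sup q z).
move=> _ [d [->|[/andP[d0 d1] qz]] <-].
  by have := bump_ge0 q z'; lra.
have [de|de] := lerP (d + e) 1; last by have := bump_ge0 q z'; lra.
have := bump_ball (_ : 0 < d + e <= 1) (ball_triangle qz zz').
by rewrite de andbT => /(_ ltac:(lra)); lra.
Qed.

End CompactPseudometric.

(** * Ternary sums *)

Section TernarySum.
Context {R : realType}.
Implicit Types u w : nat -> R.

(** The coefficients are real because the sum serves twice: with bits it gives the points of the
    middle-third set, with values in [[0, 1]] it gives the height. The weights add up to 1, so a
    uniform error in the coefficients passes unchanged to the sum. *)
Definition ternary_sum u : R := limn (series (fun k => u k * 2 / 3 ^+ k.+1)).

Let weight_sum n : \sum_(0 <= k < n) (2 / 3 ^+ k.+1) = 1 - 3 ^- n :> R.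
Proof.
elim: n => [|n IH]; first by rewrite big_geq // expr0 invr1 subrr.
rewrite big_nat_recr //= IH exprS invfM.
by set t := 3 ^- n; lra.
Qed.

Let partial_le u w e n : 0 <= e -> (forall k, u k <= w k + e) ->
  series (fun k => u k * 2 / 3 ^+ k.+1) n <=
  series (fun k => w k * 2 / 3 ^+ k.+1) n + e.
Proof.
move=> e0 uw.
apply: (@le_trans _ _ (series (fun k => w k * 2 / 3 ^+ k.+1) n +
   e * \sum_(0 <= k < n) (2 / 3 ^+ k.+1))).
  rewrite /series /= mulr_sumr -big_split /=; apply: ler_sum => k _.
  have h : (0 : R) < 3 ^- k.+1 by rewrite invr_gt0 exprn_gt0.
  rewrite -!mulrA -mulrDl; apply: ler_wpM2r (uw k).
  by rewrite mulr_ge0 // ltW.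
rewrite lerD2l -[leRHS]mulr1 ler_wpM2l // weight_sum lerBlDr lerDl.
by rewrite invr_ge0 exprn_ge0.
Qed.

Lemma cvg_ternary_sum u : (forall k, 0 <= u k <= 1) ->
  series (fun k => u k * 2 / 3 ^+ k.+1) @ \oo --> ternary_sum u.
Proof.
move=> u01.
apply: nondecreasing_is_cvgn.
  apply/nondecreasing_seqP => n; rewrite /series /= big_nat_recr //= lerDl.
  have /andP[u0 _] := u01 n.
  by rewrite mulr_ge0 ?mulr_ge0 // invr_ge0 exprn_ge0.
exists 1 => _ [n _ <-].
have : series (fun k => u k * 2 / 3 ^+ k.+1) n <=
   series (fun k => 0 * 2 / 3 ^+ k.+1) n + 1.
  by apply: partial_le => // k; rewrite add0r; have /andP[] := u01 k.
move/le_trans; apply; rewrite /series /= big1 ?add0r // => k _.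
by rewrite !mul0r.
Qed.

Lemma ternary_sumS u : (forall k, 0 <= u k <= 1) ->
  ternary_sum u = (2 * u 0%N + ternary_sum (fun k => u k.+1)) / 3.
Proof.
move=> u01; have c1 := cvg_ternary_sum u01.
have c2 := cvg_ternary_sum (fun k => u01 k.+1).
have c3 : (2 * u 0%N + series (fun k => u k.+1 * 2 / 3 ^+ k.+1) n) / 3 @[n --> \oo]
   --> (2 * u 0%N + ternary_sum (fun k => u k.+1)) / 3.
  by apply: cvgMl; apply: cvgD => //; exact: cvg_cst.
move: c1; rewrite -cvg_shiftS /= => c1.
apply: (cvg_unique (@Rhausdorff R) c1).
apply: cvg_trans c3; apply: near_eq_cvg; near=> n.
rewrite /series /= big_nat_recl //= mulrDl mulr_suml; congr (_ + _).
  by rewrite expr1 (mulrC 2).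
apply: eq_bigr => k _; rewrite [3 ^+ k.+2]exprSr invfM.
by rewrite !mulrA.
Unshelve. all: by end_near. Qed.

Lemma ternary_sum_le u w e : 0 <= e ->
  (forall k, 0 <= u k <= 1) -> (forall k, 0 <= w k <= 1) ->
  (forall k, u k <= w k + e) -> ternary_sum u <= ternary_sum w + e.
Proof.
move=> e0 u01 w01 uw.
have cu := cvg_ternary_sum u01; have cw := cvg_ternary_sum w01.
have cwe : series (fun k => w k * 2 / 3 ^+ k.+1) n + e @[n --> \oo]
   --> ternary_sum w + e by apply: cvgD => //; exact: cvg_cst.
rewrite -(cvg_lim (@Rhausdorff R) cwe).
apply: ler_lim; [by apply/cvg_ex; exists (ternary_sum u)|
  by apply/cvg_ex; exists (ternary_sum w + e)|].
by apply: nearW => n; exact: partial_le.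
Qed.

Lemma ternary_sum_itv u : (forall k, 0 <= u k <= 1) -> 0 <= ternary_sum u <= 1.
Proof.
move=> u01.
have s0 : ternary_sum (fun=> 0) = 0.
  have := @ternary_sumS (fun=> 0) (fun=> ltac:(by rewrite lexx ler01)).
  by rewrite /=; lra.
have z01 (k : nat) : 0 <= (0 : R) <= 1 by rewrite lexx ler01.
have l0 : ternary_sum (fun=> 0) <= ternary_sum u + 0.
  apply: (@ternary_sum_le (fun=> 0) u 0 _ z01 u01) => // k.
  by rewrite addr0; have /andP[] := u01 k.
have l1 : ternary_sum u <= ternary_sum (fun=> 0) + 1.
  apply: (@ternary_sum_le u (fun=> 0) 1 _ u01 z01) => // k.
  by rewrite add0r; have /andP[] := u01 k.
by move: l0 l1; rewrite s0 addr0 add0r => -> ->.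
Qed.

Lemma ternary_sum_lt u w k :
  (forall k, 0 <= u k <= 1) -> (forall k, 0 <= w k <= 1) ->
  (forall k, u k <= w k) -> u k < w k -> ternary_sum u < ternary_sum w.
Proof.
elim: k u w => [|k IH] u w u01 w01 uw uwk;
    rewrite (ternary_sumS u01) (ternary_sumS w01).
  have : ternary_sum (fun k => u k.+1) <= ternary_sum (fun k => w k.+1) + 0.
    by apply: ternary_sum_le => // k; rewrite addr0.
  by lra.
have := uw 0%N.
have := IH _ _ (fun j => u01 j.+1) (fun j => w01 j.+1) (fun j => uw j.+1) uwk.
by lra.
Qed.

Let bits01 (a : nat -> bool) k : 0 <= ((a k)%:R : R) <= 1.
Proof. by case: (a k); rewrite /= lexx ler01. Qed.

Definition cantor_real (a : nat -> bool) : R := ternary_sum (fun k => (a k)%:R).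

(** The first bit decides between [[0, 1/3]] and [[2/3, 1]]; once it is known, the tails have equal
    sums and the induction goes on with them. *)
Lemma cantor_real_inj : injective cantor_real.
Proof.
move=> a b ab; apply/funext => k; elim: k a b ab => [|k IH] a b;
  rewrite /cantor_real (ternary_sumS (bits01 a)) (ternary_sumS (bits01 b));
  have := ternary_sum_itv (bits01 (fun k => a k.+1));
  have := ternary_sum_itv (bits01 (fun k => b k.+1)).
  case: (a 0%N); case: (b 0%N) => //= /andP[b0 b1] /andP[a0 a1] h;
  by exfalso; move: b0 b1 a0 a1 h; rewrite -/(cantor_real _); lra.
move=> /andP[b0 b1] /andP[a0 a1] h.
apply: (IH (fun k => a k.+1) (fun k => b k.+1)).
move: b0 b1 a0 a1 h; rewrite /cantor_real.
by case: (a 0%N); case: (b 0%N) => /=; lra.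
Qed.

Lemma cantor_real_dist n (a b : nat -> bool) :
  (forall k, (k < n)%N -> a k = b k) ->
  `|cantor_real a - cantor_real b| <= 3 ^- n.
Proof.
elim: n a b => [|n IH] a b ab.
  rewrite expr0 invr1 ler_norml.
  have := ternary_sum_itv (bits01 a); have := ternary_sum_itv (bits01 b).
  by rewrite -!/(cantor_real _) => /andP[? ?] /andP[? ?]; apply/andP; split; lra.
rewrite /cantor_real (ternary_sumS (bits01 a)) (ternary_sumS (bits01 b)).
rewrite ab // -mulrBl opprD addrACA subrr add0r exprSr invfM normrM.
rewrite [`|3^-1|]ger0_norm ?ler_wpM2r //.
by apply: (IH (fun k => a k.+1) (fun k => b k.+1)) => k kn; exact: ab.
Qed.

Lemma cantor_middle_thirdE :
  @cantor_middle_third R = range cantor_real.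
Proof.
apply/seteqP; split=> [x [a ax]|_ [a _ <-]]; exists a => //.
  exact: (cvg_lim (@Rhausdorff R) ax).
exact: cvg_ternary_sum.
Qed.

End TernarySum.

(** * The order of a Lelek fan *)

Lemma closed_preimage {T U : topologicalType} (f : T -> U) (D : set U) :
  continuous f -> closed D -> closed (f @^-1` D).
Proof. by move=> cf; apply: preimage_closed => x _; exact: cf. Qed.

Lemma continuous_pair {T U V : topologicalType} (f : T -> U) (g : T -> V) :
  continuous f -> continuous g -> continuous (fun x => (f x, g x)).
Proof. by move=> cf cg x; apply: cvg_pair; [exact: cf|exact: cg]. Qed.

Section LelekOrder.
Context {R : realType} (T : pseudoMetricType R).
Implicit Types (x y z m : T) (le : T -> T -> Prop).

Definition maximal_elt le : set T := [set m | forall y, le m y -> y = m].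

(** [lo_fork] expresses that branching occurs at [v] only, [lo_smooth] is smoothness in
    epsilon-delta form (down-sets of nearby points are Hausdorff-close), and [lo_dense] is the
    density of the end points, which are the maximal elements. *)
Record lelek_order (v : T) le : Prop := LelekOrder {
  lo_compact : compact [set: T];
  lo_hausdorff : hausdorff_space T;
  lo_refl : forall x, le x x;
  lo_trans : forall x y z, le x y -> le y z -> le x z;
  lo_anti : forall x y, le x y -> le y x -> x = y;
  lo_min : forall x, le v x;
  lo_chain : forall x y z, le x z -> le y z -> le x y \/ le y x;
  lo_fork : forall x y z, x <> v -> le x y -> le x z -> le y z \/ le z y;
  lo_connected : forall x, connected [set y | le y x];
  lo_closed : forall x, closed [set y | le y x];
  lo_smooth : forall x e, 0 < e -> exists2 d : R, 0 < d &
    forall x', ball x d x' ->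
      (forall y', le y' x' -> exists2 y, le y x & ball y e y') /\
      (forall y, le y x -> exists2 y', le y' x' & ball y' e y);
  lo_nontrivial : exists x, x <> v;
  lo_dense : forall x e, 0 < e -> exists2 m, maximal_elt le m & ball x e m }.

Variables (v : T) (le : T -> T -> Prop).
Hypothesis ord : lelek_order v le.

(** If [x' <= y'] with [(x', y')] near [(x, y)], smoothness at [y] replaces [x'] by a nearby point
    below [y]; the down-set of [y] is closed, so it contains [x]. *)
Lemma le_graph_closed : closed [set p : T * T | le p.1 p.2].
Proof.
move=> [x y] clxy; apply: (lo_closed ord) => /= B /nbhs_ballP[e /= e0 eB].
have [d d0 dP] := lo_smooth ord y (divr_gt0 e0 (ltr0Sn R 1)).
have nxy : nbhs (x, y) (ball x (e / 2) `*` ball y d).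
  by exists (ball x (e / 2), ball y d) => //; split; apply: nbhsx_ballx;
    rewrite ?divr_gt0.
have [[x' y'] /= [le' [xx' yy']]] := clxy _ nxy.
have [z zy zx'] := (dP _ yy').1 _ le'.
exists z; split=> //; apply: eB; apply: (ball_split xx'); exact: ball_sym.
Qed.

Lemma upset_closed x : closed [set y | le x y].
Proof.
apply: (@closed_preimage _ _ (fun y => (x, y)) [set p : T * T | le p.1 p.2]).
  by apply: continuous_pair => y; [exact: cvg_cst|exact: cvg_id].
exact: le_graph_closed.
Qed.

(** Otherwise [x] would be isolated in its own down-set, which is connected and also contains
    [v]. *)
Lemma below_arbitrarily_close x (W : set T) : x <> v -> open W -> W x ->
  exists y, [/\ W y, le y x & y <> x].
Proof.
move=> xv oW Wx; apply: contrapT => nex.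
have eqx : [set x] = [set y | le y x].
  apply: (lo_connected ord); first by exists x.
    exists W => //; apply/seteqP; split=> [_ ->|y [yx Wy]].
      by split=> //; exact: (lo_refl ord).
    by apply: contrapT => yx'; apply: nex; exists y; split=> // /esym.
  exists [set x].
    exact/accessible_closed_set1/hausdorff_accessible/(lo_hausdorff ord).
  apply/seteqP; split=> [_ ->|y []//]; split=> //; exact: (lo_refl ord).
have : [set y | le y x] v by exact: (lo_min ord).
by rewrite -eqx => /esym.
Qed.

Lemma maximal_neq_min m : maximal_elt le m -> m <> v.
Proof.
move=> mm mv; have [x] := lo_nontrivial ord; apply.
by rewrite -mv; apply: mm; rewrite mv; exact: (lo_min ord).
Qed.

Lemma open_not_maximal (W : set T) : open W -> W !=set0 ->
  exists2 y, W y & ~ maximal_elt le y.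
Proof.
move=> oW [x Wx]; apply: contrapT => nex.
have mx : maximal_elt le x by apply: contrapT => nx; apply: nex; exists x.
have [y [Wy yx neyx]] := below_arbitrarily_close (maximal_neq_min mx) oW Wx.
by apply: nex; exists y => // /(_ _ yx)/esym.
Qed.

Lemma open_two_points (W : set T) : open W -> W !=set0 ->
  exists x y, [/\ W x, W y & x <> y].
Proof.
move=> oW [x Wx]; have [xv|xv] := pselect (x = v); last first.
  have [y [Wy yx neyx]] := below_arbitrarily_close xv oW Wx.
  by exists y, x.
have [e e0 eW] : exists2 e : R, 0 < e & ball x e `<=` W.
  by apply/nbhs_ballP; exact: open_nbhs_nbhs.
have [m mm xm] := lo_dense ord x e0.
exists x, m; split=> //; first exact: eW.
by move=> xm'; apply: (maximal_neq_min mm); rewrite -xm'.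
Qed.

Variable q : nat -> T.
Hypothesis q_dense : forall x e, 0 < e -> exists n, ball (q n) e x.

(** The supremum over the down-set makes the bump monotone along the order: the usual ingredient of
    a Whitney map, evaluated at the arc from [v] to [x]. *)
Definition sup_bump n x : R := sup [set bump (q n) y | y in [set y | le y x]].

Let sup_bump_has_sup n x : has_sup [set bump (q n) y | y in [set y | le y x]].
Proof.
split; first by exists (bump (q n) x); exists x => //; exact: (lo_refl ord).
by exists 1 => _ [y _ <-]; exact: bump_le1.
Qed.

Let bump_le_sup n x y : le y x -> bump (q n) y <= sup_bump n x.
Proof.
by move=> yx; apply: ub_le_sup; [case: (sup_bump_has_sup n x)|exists y].
Qed.

Let sup_bump01 n x : 0 <= sup_bump n x <= 1.
Proof.
apply/andP; split.
  apply: le_trans (bump_le_sup n (lo_refl ord x)); exact: bump_ge0.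
apply: ge_sup; first by case: (sup_bump_has_sup n x).
by move=> _ [y _ <-]; exact: bump_le1.
Qed.

Definition height x : R :=
  ternary_sum (sup_bump^~ x) - ternary_sum (sup_bump^~ v).

Lemma height_min : height v = 0.
Proof. exact: subrr. Qed.

Lemma height_lt x y : le x y -> x <> y -> height x < height y.
Proof.
move=> xy nexy; rewrite /height ltrD2r.
have nyx : ~ le y x by move=> yx; apply: nexy; exact: (lo_anti ord).
have [e e0 eB] : exists2 e : R, 0 < e & ball y e `<=` ~` [set z | le z x].
  apply/nbhs_ballP; apply: open_nbhs_nbhs; split=> //.
  by apply: closed_openC; exact: (lo_closed ord).
(* A point [q n] within [d / 2] of [y] has bump at least [1 - d / 2] there, but at most [1 - d] on
   the down-set of [x], because [d / 2 + d <= e]. The minimum with 1 is taken since bumps only see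
   radii up to 1. *)
pose d := Order.min e 1 / 2.
have m0 : 0 < Order.min e 1 by rewrite lt_min e0 ltr01.
have me : Order.min e 1 <= e by rewrite ge_min lexx.
have m1 : Order.min e 1 <= 1 by rewrite ge_min lexx orbT.
have d0 : 0 < d by rewrite /d; lra.
have [n qny] := q_dense y (divr_gt0 d0 (ltr0Sn R 1)).
apply: (@ternary_sum_lt _ _ _ n) => [k|k|k|].
- exact: sup_bump01.
- exact: sup_bump01.
- apply: ge_sup; first by case: (sup_bump_has_sup k x).
  by move=> _ [z zx <-]; apply: bump_le_sup; exact: (lo_trans ord) xy.
- apply: (@le_lt_trans _ _ (1 - d)).
    apply: ge_sup; first by case: (sup_bump_has_sup n x).
    move=> _ [z zx <-]; rewrite leNgt; apply/negP => /ball_bump qnz.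
    apply: (eB z) => //; apply: (@le_ball _ _ _ (d / 2 + d)).
      by rewrite /d; lra.
    apply: (ball_triangle (ball_sym qny)); apply: qnz.
    by rewrite /d; lra.
  apply: (@lt_le_trans _ _ (1 - d / 2)); first by lra.
  apply: le_trans (bump_le_sup n (lo_refl ord y)).
  by apply: bump_ball => //; apply/andP; split; rewrite /d; lra.
Qed.

Lemma height_le x y : le x y -> height x <= height y.
Proof.
move=> xy; have [->//|/eqP ne] := eqVneq x y.
exact/ltW/height_lt.
Qed.

Lemma height_gt0 x : x <> v -> 0 < height x.
Proof.
move=> xv; rewrite -height_min; apply: height_lt; first exact: (lo_min ord).
by move/esym.
Qed.

(** Smoothness and the Lipschitz bound change all the [sup_bump k] by at most the same [e], and
    [ternary_sum_le] passes this bound on to the sum. *)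
Lemma height_continuous : continuous height.
Proof.
move=> x; apply/cvgrPdist_le => e e0.
have [d d0 dP] := lo_smooth ord x e0.
apply: filterS (nbhsx_ballx x d d0) => x' /dP[h1 h2].
have cmp a b : (forall y, le y a -> exists2 y', le y' b & ball y' e y) ->
    forall k, sup_bump k a <= sup_bump k b + e.
  move=> ab k; apply: ge_sup; first by case: (sup_bump_has_sup k a).
  move=> _ [y /ab[y' y'b y'y] <-].
  have := bump_lipschitz (q k) e0 (ball_sym y'y).
  by have := bump_le_sup k y'b; lra.
have l1 := ternary_sum_le (ltW e0) (sup_bump01^~ x') (sup_bump01^~ x) (cmp _ _ h1).
have l2 := ternary_sum_le (ltW e0) (sup_bump01^~ x) (sup_bump01^~ x') (cmp _ _ h2).
by rewrite /height opprB addrA subrK ler_norml; apply/andP; split; lra.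
Qed.

(** A point of greatest height in the compact up-set of [x] is maximal, as the height is strictly
    increasing. *)
Lemma below_maximal x : exists2 m, maximal_elt le m & le x m.
Proof.
have cU : compact [set y | le x y].
  apply: (subclosed_compact _ (lo_compact ord)) => //; exact: upset_closed.
have [||m /set_mem /= xm mmax] := compact_EVT_max (f := height) _ cU.
- by exists x; exact: (lo_refl ord).
- exact/continuous_subspaceT/height_continuous.
exists m => // y my; apply: contrapT => /nesym /(height_lt my).
by rewrite ltNge mmax //; apply/mem_set; exact: (lo_trans ord) my.
Qed.

(** These sets exhaust the non-maximal points, so their complements present the maximal points as a
    G_delta; the fixed gap is what makes each of them closed. *)
Definition height_gap n : set T :=
  [set x | exists2 y, le x y & height x + n.+1%:R^-1 <= height y].

Lemma height_gap_closed n : closed (height_gap n).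
Proof.
(* The set is the projection of a closed subset of the compact square, hence compact. *)
have -> : height_gap n = fst @` ([set p : T * T | le p.1 p.2] `&`
    (fun p => height p.2 - height p.1) @^-1` [set t | n.+1%:R^-1 <= t]).
  apply/seteqP; split=> [x [y xy xyn]|_ [[x y] /= [xy xyn] <-]].
    by exists (x, y) => //; split=> //=; rewrite lerBrDl.
  by exists y => //; rewrite -lerBrDl.
apply: compact_closed; first exact: (lo_hausdorff ord).
apply: continuous_compact.
  by apply: continuous_subspaceT => p; exact: cvg_fst.
apply: (subclosed_compact _ (compact_setX (lo_compact ord) (lo_compact ord))) => //.
apply: closedI; first exact: le_graph_closed.
apply: closed_preimage; last exact: closed_ge.
move=> p; apply: cvgB.
  by apply: (cvg_comp snd height); [exact: cvg_snd|exact: height_continuous].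
by apply: (cvg_comp fst height); [exact: cvg_fst|exact: height_continuous].
Qed.

Lemma maximal_eltE : maximal_elt le = \bigcap_n ~` height_gap n.
Proof.
apply/seteqP; split=> [m mm n _ [y /mm -> h]|x xn y xy].
  by move: h; rewrite gerDl leNgt invr_gt0 ltr0Sn.
apply: contrapT => /nesym/(height_lt xy); rewrite -subr_gt0 => h.
have [k _ /(_ _ (leqnn _)) /= hk] := near_infty_natSinv_lt (PosNum h).
by apply: (xn k I); exists y => //; rewrite -lerBrDl ltW.
Qed.

Lemma between_height x t : 0 <= t <= height x -> exists2 y, le y x & height y = t.
Proof.
move=> t01.
have : connected (height @` [set y | le y x]).
  apply: connected_continuous_connected; first exact: (lo_connected ord).
  exact/continuous_subspaceT/height_continuous.
move/connected_intervalP => /(_ 0 (height x)).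
case/(_ _ _ t t01) => //.
- by exists v; [exact: (lo_min ord)|exact: height_min].
- by exists x => //; exact: (lo_refl ord).
- by move=> y yx <-; exists y.
Qed.

End LelekOrder.

(** * Cantor schemes *)

Section CantorScheme.
Context {R : realType} (T : pseudoMetricType R).

Definition cantor_continuous (g : (nat -> bool) -> T) := forall a (e : R), 0 < e ->
  exists n, forall b, (forall k, (k < n)%N -> a k = b k) -> ball (g a) e (g b).

Lemma nbhs_cantor_prefix (a : cantor_space) n :
  nbhs a [set b : cantor_space | forall k, (k < n)%N -> a k = b k].
Proof.
elim: n => [|n IH]; first by apply: filterS filterT.
have : nbhs a ((proj n : cantor_space -> bool) @^-1` [set a n]).
  apply: (@proj_continuous nat (fun=> bool) n a).
  exact: discrete_set1.
move/(filterI IH); apply: filterS => b [bk bn] k.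
by rewrite ltnS leq_eqVlt => /orP[/eqP -> //|/bk].
Qed.

Lemma cantor_continuousP g : cantor_continuous g ->
  continuous (g : cantor_space -> T).
Proof.
move=> cg a; apply/cvg_ballP => e e0; have [n nP] := cg a _ e0.
by apply: filterS (nbhs_cantor_prefix a n) => b; exact: nP.
Qed.

Lemma cantor_range_closed g : hausdorff_space T -> cantor_continuous g ->
  closed (range g).
Proof.
move=> hT /cantor_continuousP cg; apply: compact_closed => //.
have := cantor_space_compact; apply: (@continuous_compact cantor_space T g).
exact: continuous_subspaceT.
Qed.

Lemma closure_ball_sub (x : T) (c c' : R) : 0 < c' ->
  closure (ball x c) `<=` ball x (c + c').
Proof.
move=> c'0 y /(_ _ (nbhsx_ballx y c' c'0)) [z [xz yz]].
exact: ball_triangle xz (ball_sym yz).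
Qed.

Lemma cantor_split_step (O V : set T) (e : R) : hausdorff_space T -> 0 < e ->
  open O -> open V -> (exists x y, [/\ (O `&` V) x, (O `&` V) y & x <> y]) ->
  exists F : bool -> set T,
    (forall b, [/\ open (F b), F b !=set0, closure (F b) `<=` O `&` V &
       forall x y, F b x -> F b y -> ball x e y]) /\
    F false `&` F true = set0.
Proof.
rewrite ball_hausdorff => hT e0 oO oV [x [y [xOV yOV /eqP xy]]].
have [r /= /eqP r12] := hT _ _ xy.
have r10 : 0 < r.1%:num by [].
have r20 : 0 < r.2%:num by [].
move: (r.1%:num) (r.2%:num) r10 r20 r12 => r1 r2 r10 r20 r12.
have oOV : open (O `&` V) by exact: openI.
have [d1 /= d10 d1P] : exists2 d : R, 0 < d & ball x d `<=` O `&` V.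
  by apply/nbhs_ballP; exact: open_nbhs_nbhs.
have [d2 /= d20 d2P] : exists2 d : R, 0 < d & ball y d `<=` O `&` V.
  by apply/nbhs_ballP; exact: open_nbhs_nbhs.
(* Radius [c] keeps the two balls apart ([r1], [r2]). The halving is for [2 * c], which bounds the
   distance between two points of one ball ([e]) and the radius of a ball around its closure ([d1],
   [d2]). *)
pose c := Order.min (Order.min r1 r2) (Order.min (Order.min d1 d2) e) / 2.
have c0 : 0 < c by rewrite divr_gt0 // !lt_min r10 r20 d10 d20 e0.
have [cr1 cr2 cd1 cd2 ce] :
    [/\ c + c <= r1, c + c <= r2, c + c <= d1, c + c <= d2 & c + c <= e].
  by rewrite /c -splitr; split; rewrite !ge_min lexx ?orbT.
have cr1' : c <= r1 by lra.
have cr2' : c <= r2 by lra.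
exists (fun b => (ball (if b then y else x) c)°); split.
  case; split.
  - exact: open_interior.
  - by exists y; exact: nbhsx_ballx.
  - apply: subset_trans (closureS (@interior_subset _ _)) _.
    by apply: subset_trans (closure_ball_sub c0) _; apply: subset_trans d2P; exact: le_ball.
  - move=> z w /interior_subset yz /interior_subset yw.
    by apply: le_ball ce _ _; exact: ball_triangle (ball_sym yz) yw.
  - exact: open_interior.
  - by exists x; exact: nbhsx_ballx.
  - apply: subset_trans (closureS (@interior_subset _ _)) _.
    by apply: subset_trans (closure_ball_sub c0) _; apply: subset_trans d1P; exact: le_ball.
  - move=> z w /interior_subset yz /interior_subset yw.
    by apply: le_ball ce _ _; exact: ball_triangle (ball_sym yz) yw.
rewrite -subset0 => z [/interior_subset xz /interior_subset yz].
by rewrite -r12; split; [exact: le_ball xz|exact: le_ball yz].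
Qed.

(** A Cantor scheme: [node a n] depends on the first [n] bits of [a], the closure of each successor
    lies in its parent and in [U n], and siblings are disjoint. Vanishing diameters give continuity,
    disjoint siblings at the first differing bit give injectivity. *)
Lemma cantor_set_in_Gdelta (U : nat -> set T) (W : set T) :
  compact [set: T] -> hausdorff_space T ->
  (forall n, open (U n)) ->
  (forall n O, open O -> O !=set0 -> (O `&` U n) !=set0) ->
  (forall O : set T, open O -> O !=set0 -> exists x y, [/\ O x, O y & x <> y]) ->
  open W -> W !=set0 ->
  exists g : (nat -> bool) -> T, [/\ cantor_continuous g, injective g &
    forall a, W (g a) /\ forall n, U n (g a)].
Proof.
move=> cT hT oU dU two oW W0.
have /choice[F FP] (On : set T * nat) : exists F : bool -> set T,
    open On.1 -> On.1 !=set0 ->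
    (forall b, [/\ open (F b), F b !=set0, closure (F b) `<=` On.1 `&` U On.2 &
       forall x y, F b x -> F b y -> ball x (On.2.+1%:R^-1 : R) y]) /\
    F false `&` F true = set0.
  case: On => O n /=.
  have [[oO O0]|nO] := pselect (open O /\ O !=set0); last first.
    by exists (fun=> set0) => oO O0; exfalso; exact: nO.
  have [||x [y [Ox Oy xy]]] := two (O `&` U n); [exact: openI|exact: dU|].
  have e0 : (0 : R) < n.+1%:R^-1 by rewrite invr_gt0.
  have [|G GP] := cantor_split_step hT e0 oO (oU n); first by exists x, y.
  by exists G.
pose node a := fix node n := if n is k.+1 then F (node k, k) (a k) else W.
have nodeP a n : open (node a n) /\ node a n !=set0.
  elim: n => [//|n [on n0]] /=.
  by have [/(_ (a n))[]] := FP (_, n) on n0.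
have node_sub a n : closure (node a n.+1) `<=` node a n `&` U n.
  have [on n0] := nodeP a n.
  by have [/(_ (a n))[]] := FP (_, n) on n0.
have node_decr a n m : (n <= m)%N -> node a m `<=` node a n.
  move/subnKC <-; elim: (m - n)%N => [|k IH]; first by rewrite addn0.
  rewrite addnS => x /subset_closure /node_sub [] + _; exact: IH.
have node_eq a b n : (forall k, (k < n)%N -> a k = b k) -> node a n = node b n.
  elim: n => //= n IH ab; rewrite ab // IH // => k kn.
  by apply: ab; exact: ltnW.
(* A cluster point of any selection from the nodes lies in the closure of every successor node,
   hence in every node. *)
have /choice[g gP] a : exists p, forall n, node a n p.
  have /choice[x xP] n : exists x, node a n x by case: (nodeP a n).
  have [p [_ clp]] := cT (x n @[n --> \oo]) _ filterT.
  exists p => n; suff : closure (node a n.+1) p by move/node_sub => [].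
  move=> B pB; have [|z [nz Bz]] := clp (node a n.+1) B _ pB; last by exists z.
  exists n.+1 => // m /= nm; exact: (node_decr a) nm _ (xP m).
exists g; split.
- move=> a e e0.
  have [k _ /(_ _ (leqnn _)) /ltW hk] := near_infty_natSinv_lt (PosNum e0).
  exists k.+1 => b ab; apply: le_ball hk _ _.
  have [on n0] := nodeP a k.
  have [/(_ (a k))[_ _ _ small] _] := FP (_, k) on n0.
  apply: small; first exact: (gP a k.+1).
  by have := gP b k.+1; rewrite -(node_eq _ _ _ ab).
- move=> a b gab; apply: contrapT => nab.
  have ex : exists k, a k != b k.
    apply: contrapT => nex; apply: nab; apply/funext => k; apply/eqP.
    by apply: contrapT => /negP nk; apply: nex; exists k.
  case: (ex_minnP ex) => k abk kmin.
  have ab : node a k = node b k.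
    apply: node_eq => j jk; apply/eqP; apply: contraLR jk => /kmin.
    by rewrite -leqNgt.
  have [on n0] := nodeP a k.
  have [_ dis] := FP (_, k) on n0.
  have ga := gP a k.+1; have gb := gP b k.+1.
  move: ga gb; rewrite /= -ab gab; case: (a k) (b k) abk => -[] //= _ ga gb.
    by have : set0 (g b) by rewrite -dis.
  by have : set0 (g b) by rewrite -dis.
- move=> a; split; first exact: (gP a 0%N).
  by move=> n; have /subset_closure/node_sub[] := gP a n.+1.
Qed.

End CantorScheme.

(** * Partitions into Cantor sets *)

Lemma injections_set_bij {T U : Type} (u0 : U) (A : set T) (B : set U)
    (f : T -> U) (g : U -> T) :
  set_fun A B f -> set_inj A f -> set_fun B A g -> set_inj B g ->
  exists h, set_bij A B h.
Proof.
move=> fAB finj gBA ginj.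
have AB : (A #<= B)%card.
  by have [F] := injfunPex.2 (ex_intro2 _ _ f fAB finj); exact: inj_card_le.
have BA : (B #<= A)%card.
  by have [F] := injfunPex.2 (ex_intro2 _ _ g gBA ginj); exact: inj_card_le.
have /card_bijP[h [h' hK h'K]] := Cantor_Bernstein AB BA.
(* Cantor-Bernstein gives a bijection of subtypes; [u0] is a dummy value outside [A]. *)
exists (fun x => if pselect (A x) is left Ax then set_val (h (SigSub (mem_set Ax)))
                 else u0); split.
- by move=> x Ax; case: pselect => // Ax'; exact: set_valP.
- move=> x y /set_mem Ax /set_mem Ay.
  case: pselect => // Ax'; case: pselect => // Ay' /val_inj/(can_inj hK).
  by move/(congr1 val).
- move=> y By; pose x := h' (SigSub (mem_set By)).
  have Ax : A (set_val x) by exact: set_valP.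
  exists (set_val x) => //; case: pselect => // Ax'.
  have -> : SigSub (mem_set Ax') = x by exact: val_inj.
  by rewrite /x h'K.
Qed.

(** * Codings of bit sequences *)

Section BitSequences.
Implicit Types a b c d : nat -> bool.

(** Fixing [c] and letting [d] vary selects a slice of the Cantor space, again a Cantor set: this is
    how one Cantor set is cut into continuum many. *)
Definition interleave c d : nat -> bool :=
  fun k => if odd k then d k./2 else c k./2.

Definition bcons (b : bool) c : nat -> bool := fun k => if k is k'.+1 then c k' else b.

(** For fixed [j] these sequences form a block homeomorphic to the Cantor space; the blocks shrink
    to the zero sequence, the one sequence outside all of them. *)
Definition zeros_one j d : nat -> bool :=
  fun k => if (k < j)%N then false else if k == j then true else d (k - j.+1)%N.

Lemma interleave_inj c d c' d' : interleave c d = interleave c' d' -> c = c' /\ d = d'.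
Proof.
move=> e; split; apply/funext => k.
  by have := congr1 (fun h => h k.*2) e; rewrite /interleave odd_double doubleK.
have := congr1 (fun h => h k.*2.+1) e.
by rewrite /interleave /= odd_double /= uphalf_double.
Qed.

Lemma interleave_split a :
  interleave (fun k => a k.*2) (fun k => a k.*2.+1) = a.
Proof.
apply/funext => k; rewrite /interleave; have := odd_double_half k.
by case: (odd k) => /= h; congr a; rewrite -[RHS]h.
Qed.

Lemma interleave_prefix c d d' n : (forall k, (k < n)%N -> d k = d' k) ->
  forall k, (k < n)%N -> interleave c d k = interleave c d' k.
Proof.
move=> dd' k kn; rewrite /interleave; case: ifP => // _; apply: dd'.
by apply: leq_ltn_trans kn; rewrite -{2}(odd_double_half k) -addnn addnA leq_addl.
Qed.

Lemma bcons_inj (b b' : bool) c c' : bcons b c = bcons b' c' -> b = b' /\ c = c'.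
Proof.
move=> e; split; first exact: (congr1 (fun h => h 0%N) e).
by apply/funext => k; exact: (congr1 (fun h => h k.+1) e).
Qed.

Lemma zeros_one_inj j d d' : zeros_one j d = zeros_one j d' -> d = d'.
Proof.
move=> e; apply/funext => k; have := congr1 (fun h => h (k + j.+1)%N) e.
rewrite /zeros_one; case: ifP; first lia; case: eqP; first lia.
by rewrite addnK.
Qed.

(** The first [j.+1] bits identify the block, so agreement there keeps [a] in it; the remaining [n]
    bits compare the tails. *)
Lemma zeros_one_prefix j d a n :
  (forall k, (k < j.+1 + n)%N -> zeros_one j d k = a k) ->
  exists2 d', a = zeros_one j d' & forall k, (k < n)%N -> d k = d' k.
Proof.
move=> da; exists (fun k => a (j.+1 + k)%N).
  apply/funext => k; rewrite /zeros_one; case: ltngtP => [kj|jk|->].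
  - by rewrite -da /zeros_one ?kj //; lia.
  - by rewrite subnKC.
  - by rewrite -da /zeros_one ?ltnn ?eqxx // ltn_addr.
move=> k kn; rewrite -da ?ltn_add2l // /zeros_one.
by case: ifP; [lia|case: eqP; [lia|rewrite addKn]].
Qed.

Lemma zeros_oneP a : a = (fun=> false) \/ exists j d, a = zeros_one j d.
Proof.
have [ex|nex] := pselect (exists j, a j); [right|left]; last first.
  by apply/funext => k; apply/negP => ak; apply: nex; exists k.
case: (ex_minnP ex) => j aj jmin; exists j.
have [|d -> _] := @zeros_one_prefix j (fun=> false) a 0; last by exists d.
move=> k; rewrite addn0 ltnS leq_eqVlt /zeros_one => /orP[/eqP ->|kj].
  by rewrite ltnn eqxx.
rewrite kj; apply/esym/negP => /jmin; by rewrite leqNgt kj.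
Qed.

Lemma zeros_one_neq0 j d : zeros_one j d <> (fun=> false).
Proof. by move/(congr1 (fun h => h j)); rewrite /zeros_one ltnn eqxx. Qed.

Lemma zeros_one_eqj j j' d d' : zeros_one j d = zeros_one j' d' -> j = j'.
Proof.
move=> e; case: (ltngtP j j') => // jj'.
  by have := congr1 (fun h => h j) e; rewrite /zeros_one ltnn eqxx jj'.
by have := congr1 (fun h => h j') e; rewrite /zeros_one ltnn eqxx jj'.
Qed.

End BitSequences.

Section CantorPartition.
Context {R : realType} (T : pseudoMetricType R) (v : T) (M : set T).
Hypothesis cT : compact [set: T].
Hypothesis hT : hausdorff_space T.
Hypothesis M_cantor : forall W : set T, open W -> W !=set0 ->
  exists g, [/\ cantor_continuous g, injective g & forall a, W (g a) /\ M (g a)].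
Hypothesis M_interior : forall W : set T, open W -> W !=set0 ->
  exists2 y, W y & ~ M y.

(** The union [K n] of the sets chosen before stage [n] is closed and contained in [M]. As [M] has
    empty interior, [V n] minus [K n] is open and nonempty, and receives the next Cantor set. *)
Lemma disjoint_cantor_sets (V : nat -> set T) :
  (forall n, open (V n)) -> (forall n, V n !=set0) ->
  exists D : nat -> (nat -> bool) -> T,
   [/\ forall n, cantor_continuous (D n),
       forall n a, V n (D n a) /\ M (D n a) &
       forall n m a b, D n a = D m b -> n = m /\ a = b].
Proof.
move=> oV V0.
have /choice[CS CSP] (W : set T) : exists g, open W -> W !=set0 ->
    [/\ cantor_continuous g, injective g & forall a, W (g a) /\ M (g a)].
  have [[oW W0]|nW] := pselect (open W /\ W !=set0); last first.
    by exists (fun=> v) => oW W0; exfalso; exact: nW.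
  by have [g gP] := M_cantor oW W0; exists g.
pose K := fix K n := if n is k.+1 then K k `|` range (CS (V k `\` K k)) else set0.
have Kstep n : closed (K n) -> K n `<=` M ->
    open (V n `\` K n) /\ V n `\` K n !=set0.
  move=> cK KM; split; first by apply: openI => //; exact: closed_openC.
  by have [y Vy nMy] := M_interior (oV n) (V0 n); exists y; split=> // /KM.
have KP n : closed (K n) /\ K n `<=` M.
  elim: n => [|n [cK KM]] /=; first by split; [exact: closed0|].
  have [oVK VK0] := Kstep n cK KM.
  have [cg _ gM] := CSP _ oVK VK0; split.
    by apply: closedU => //; exact: cantor_range_closed.
  by move=> x [/KM//|[a _ <-]]; exact: (gM a).2.
pose D n := CS (V n `\` K n).
have DP n : [/\ cantor_continuous (D n), injective (D n) &
    forall a, (V n `\` K n) (D n a) /\ M (D n a)].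
  by have [cK KM] := KP n; have [oVK VK0] := Kstep n cK KM; exact: CSP.
have Kmono n m : (n <= m)%N -> K n `<=` K m.
  move/subnKC <-; elim: (m - n)%N => [|k IH]; first by rewrite addn0.
  by rewrite addnS => x /IH; left.
have Dlt n m a b : (n < m)%N -> D n a <> D m b.
  move=> nm Dab; have [_ _ /(_ b)[[_ +] _]] := DP m; apply; rewrite -Dab.
  by apply: (Kmono _ _ nm) => /=; right; exists a.
exists D; split=> [n|n a|n m a b Dab].
- by case: (DP n).
- by have [_ _ /(_ a)[[]]] := DP n.
- case: (ltngtP n m) => nm.
  + by exfalso; exact: Dlt nm Dab.
  + by exfalso; exact: Dlt nm (esym Dab).
  + by move: Dab; rewrite nm => Dab; split=> //; have [_ inj _] := DP m; exact: inj.
Qed.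

(* A point missed by all the Cantor sets [D m] is the limit of a sequence of
   pieces of the [D m], one for each radius; together with these pieces it forms
   a Cantor set. Pieces of different points are kept apart by the code of the
   point in the Cantor space. *)
Lemma cantor_partition : exists G : T -> (nat -> bool) -> T,
  [/\ forall e, M e -> cantor_continuous (G e),
      forall e a, M e -> M (G e a),
      forall e e' a a', M e -> M e' -> G e a = G e' a' -> e = e' /\ a = a' &
      forall m, M m -> exists e a, M e /\ G e a = m].
Proof.
have [q q_dense] := compact_dense_seq v cT.
(* The code of a base member contains its radius index [j], so [pm r j] determines [j]. Numbers that
   code no pair get [setT], which is open and nonempty too. *)
pose V m : set T := if unpickle m is Some (j, i)
  then (ball (q i) (j.+1%:R^-1 : R))° else setT.
have oV n : open (V n).
  rewrite /V; case: unpickle => [[j i]|]; [exact: open_interior|exact: openT].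
have V0 n : V n !=set0.
  rewrite /V; case: unpickle => [[j i]|]; last by exists v.
  by exists (q i); apply: nbhsx_ballx; rewrite invr_gt0.
(* For each scale [j], a member of the base around the given point; twice its radius bounds the
   distance from that point to the others in it. *)
have /choice[idx0 idxP] (xj : T * nat) : exists i : nat, V (pickle (xj.2, i)) xj.1 /\
    forall y, V (pickle (xj.2, i)) y -> ball xj.1 (2 * xj.2.+1%:R^-1 : R) y.
  case: xj => x j; have d0 : (0 : R) < j.+1%:R^-1 by rewrite invr_gt0.
  have h0 := divr_gt0 d0 (ltr0Sn R 1).
  have [i qix] := q_dense x _ h0.
  have qx : V (pickle (j, i)) x.
    rewrite /V pickleK; apply/nbhs_ballP; exists (j.+1%:R^-1 / 2) => //= y xy.
    exact: ball_split qix xy.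
  exists i; split=> // y; move: qx; rewrite /V pickleK.
  move=> /interior_subset qx /interior_subset qy.
  rewrite /= mulr_natl mulr2n; exact: ball_triangle (ball_sym qx) qy.
pose pm r j := pickle (j, idx0 (r, j)).
have pm_ball r j y : V (pm r j) y -> ball r (2 * j.+1%:R^-1 : R) y.
  by have [_] := idxP (r, j); exact.
have pm_in r j : V (pm r j) r by case: (idxP (r, j)).
have pm_inj r r' j j' : pm r j = pm r' j' -> j = j'.
  by move=> /(pcan_inj pickleK)[].
have small (e : R) : 0 < e -> exists j : nat, 2 * j.+1%:R^-1 <= e.
  move=> e0.
  have [k _ /(_ _ (leqnn _)) /= hk] := near_infty_natSinv_lt (PosNum (divr_gt0 e0 (ltr0Sn R 1))).
  by exists k; rewrite mulrC -ler_pdivlMr // ltW.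
(* Membership in the base members determines the point, since arbitrarily small members surround it
   and the space is Hausdorff. *)
pose code r : nat -> bool := fun m => `[< V m r >].
have code_inj : injective code.
  move=> x y xy; apply: contrapT => /eqP nxy.
  move: (hT); rewrite ball_hausdorff => /(_ _ _ nxy)[r /eqP r12].
  have [j hj] := small _ [gt0 of r.1%:num].
  have : V (pm x j) y.
    have := congr1 (fun h => h (pm x j)) xy.
    by rewrite /code (asboolT (pm_in x j)) => /esym/asboolW.
  move=> /pm_ball xjy.
  have : set0 y.
    by rewrite -r12; split; [exact: le_ball hj _ _|exact: ballxx].
  by [].
have [D [cD DVM Dinj]] := disjoint_cantor_sets oV V0.
pose Rm : set T := [set r | M r /\ forall m a, D m a <> r].
(* The leading [false] reserves all labels beginning with [true]: no missed point ever takes such a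
   slice. *)
pose rcode r := bcons false (code r).
(* The slice [c] of [D m] no longer counts as a piece of its own once a missed point [r] has
   absorbed it. *)
pose used m c := exists r j, [/\ Rm r, m = pm r j & c = rcode r].
pose I : Type := (T + nat * (nat -> bool))%type.
pose valid : set I := [set i | match i with
  | inl r => Rm r | inr (m, c) => ~ used m c end].
(* The zero sequence goes to [r], and block [j] runs through the slice labelled [rcode r] of a
   Cantor set lying within [2 / (j + 1)] of [r]. *)
have /choice[limit limitP] r : exists g : (nat -> bool) -> T,
    g (fun=> false) = r /\
    forall j d, g (zeros_one j d) = D (pm r j) (interleave (rcode r) d).
  have /choice[g gP] a : exists x, (a = (fun=> false) -> x = r) /\
      forall j d, a = zeros_one j d -> x = D (pm r j) (interleave (rcode r) d).
    have [->|[j [d ->]]] := zeros_oneP a.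
      by exists r; split=> // j d /esym/zeros_one_neq0.
    exists (D (pm r j) (interleave (rcode r) d)); split.
      by move/zeros_one_neq0.
    move=> j' d' e; have jj' := zeros_one_eqj e; move: e; rewrite jj'.
    by move/zeros_one_inj => ->.
  exists g; split; first exact: (gP _).1.
  by move=> j d; exact: (gP _).2.
pose G i : (nat -> bool) -> T := match i with
  | inl r => limit r | inr (m, c) => fun d => D m (interleave c d) end.
have cDi m c : cantor_continuous (fun d => D m (interleave c d)).
  move=> d e e0; have [n nP] := cD m (interleave c d) _ e0.
  by exists n => d' dd'; apply: nP; exact: interleave_prefix.
have cG i : valid i -> cantor_continuous (G i).
  case: i => [r Rr|[m c] _] /=; last exact: cDi.
  have [lim0 lim1] := limitP r.
  move=> a e e0; have [->|[j [d ->]]] := zeros_oneP a; last first.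
    have [n nP] := cDi (pm r j) (rcode r) d _ e0.
    exists (j.+1 + n)%N => b /zeros_one_prefix[d' -> dd'].
    by rewrite !lim1; exact: nP.
  have [k hk] := small _ e0.
  exists k => b b0; have [->|[j [d bE]]] := zeros_oneP b; first exact: ballxx.
  rewrite bE lim0 lim1.
  (* The first [true] of [b] is at [j]; agreement with the zero sequence on [k] bits forces it to
     [k] or later, into a base member close enough to [r]. *)
  have kj : (k <= j)%N.
    rewrite leqNgt; apply/negP => /b0.
    by rewrite bE /zeros_one ltnn eqxx.
  apply: (le_ball hk); apply: (@le_ball _ _ _ (2 * j.+1%:R^-1)).
    by rewrite ler_pM2l // lef_pV2 ?posrE ?ltr0Sn // ler_nat.
  exact/pm_ball/(DVM _ _).1.
have GM i a : valid i -> M (G i a).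
  case: i => [r [Mr _]|[m c] _] /=; last exact: (DVM _ _).2.
  have [lim0 lim1] := limitP r.
  have [->|[j [d ->]]] := zeros_oneP a; first by rewrite lim0.
  rewrite lim1; exact: (DVM _ _).2.
have limit_D r j d m c d' : Rm r -> limit r (zeros_one j d) = D m (interleave c d') ->
    [/\ m = pm r j, c = rcode r & d = d'].
  move=> Rr; rewrite (limitP r).2 => /Dinj[-> /interleave_inj[-> ->]].
  by [].
have Ginj i i' a a' : valid i -> valid i' -> G i a = G i' a' -> i = i' /\ a = a'.
  case: i i' => [r|[m c]] [r'|[m' c']] /= vi vi'.
  - have [->|[j [d ->]]] := zeros_oneP a; have [->|[j' [d' ->]]] := zeros_oneP a'.
    + by rewrite (limitP r).1 (limitP r').1 => ->.
    + rewrite (limitP r).1 (limitP r').2 => rE; exfalso.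
      by have [_ /(_ _ _ (esym rE))] := vi.
    + rewrite (limitP r).2 (limitP r').1 => rE; exfalso.
      by have [_ /(_ _ _ rE)] := vi'.
    + rewrite (limitP r').2 => /(limit_D _ _ _ _ _ _ vi)[/pm_inj -> + ->].
      by move=> /bcons_inj[_ /code_inj ->].
  - have [->|[j [d ->]]] := zeros_oneP a.
      by rewrite (limitP r).1 => rE; have [_ /(_ _ _ (esym rE))] := vi.
    move=> /(limit_D _ _ _ _ _ _ vi)[mE cE _]; exfalso.
    by apply: vi'; exists r, j.
  - have [->|[j [d ->]]] := zeros_oneP a'.
      by rewrite (limitP r').1 => rE; have [_ /(_ _ _ rE)] := vi'.
    move/esym => /(limit_D _ _ _ _ _ _ vi')[mE cE _]; exfalso.
    by apply: vi; exists r', j.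
  - by move=> /Dinj[-> /interleave_inj[-> ->]].
have Gsurj m : M m -> exists i a, valid i /\ G i a = m.
  move=> Mm; have [Rr|nR] := pselect (Rm m).
    by exists (inl m), (fun=> false); split=> //=; exact: (limitP m).1.
  have [n [a Dna]] : exists n a, D n a = m.
    apply: contrapT => nex; apply: nR; split=> // n a Dna.
    by apply: nex; exists n, a.
  move: Dna; rewrite -(interleave_split a).
  move: (fun k => a k.*2) (fun k => a k.*2.+1) => c d Dncd.
  have [[r [j [Rr nE cE]]]|nu] := pselect (used n c); last first.
    by exists (inr (n, c)), d.
  exists (inl r), (zeros_one j d); split=> //=.
  by rewrite (limitP r).2 -nE -cE.
(* One injection sends [e] to a reserved slice of [D 0], labelled by the code of [e]; the other
   sends a piece to its point at the zero sequence. Pieces are disjoint, so the latter is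
   injective. *)
have [||||h [hM hinj hsurj]] := @injections_set_bij T I (inl v) M valid
  (fun e => inr (0%N, bcons true (code e))) (fun i => G i (fun=> false)).
- by move=> e _ /= [r [j [_ _ /bcons_inj[]]]].
- by move=> e e' _ _ [/bcons_inj[_ /code_inj]].
- by move=> i vi; exact: GM.
- by move=> i i' /set_mem vi /set_mem vi' /Ginj[].
exists (fun e => G (h e)); split=> [e Me|e a Me|e e' a a' Me Me'|m Mm].
- exact/cG/hM.
- exact/GM/hM.
- move=> /Ginj[||hh ->]; [exact: hM|exact: hM|split=> //].
  by apply: hinj => //; exact/mem_set.
- have [i [a [vi Gia]]] := Gsurj _ Mm.
  by have [e Me hei] := hsurj _ vi; exists e, a; rewrite hei.
Qed.

End CantorPartition.

(** * Cantor fans over Cantor sets *)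

(** Within the image of [K], the preimage of a closed set under [f] is the image under [p] of a
    closed part of [K], which is compact and therefore closed in [X]. *)
Lemma quotient_factor {Z X Y : topologicalType} (K : set Z) (p : Z -> X) (q : Z -> Y) :
  hausdorff_space X -> compact K -> K !=set0 -> continuous p -> continuous q ->
  (forall z z', K z -> K z' -> p z = p z' -> q z = q z') ->
  exists2 f : X -> Y, {within p @` K, continuous f} & forall z, K z -> f (p z) = q z.
Proof.
move=> hX cK [z0 Kz0] cp cq pq.
have /choice[f fP] x : exists y, forall z, K z -> p z = x -> q z = y.
  have [[z [Kz zx]]|nex] := pselect (exists z, K z /\ p z = x).
    by exists (q z) => z' Kz' z'x; apply: pq => //; rewrite zx.
  by exists (q z0) => z Kz zx; exfalso; apply: nex; exists z.
exists f; last by move=> z Kz; exact/esym/fP.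
apply/continuous_closedP => C cC; apply/closed_subspaceP.
exists (p @` (K `&` q @^-1` C)).
  apply: compact_closed => //; apply: continuous_compact.
    exact: continuous_subspaceT.
  by apply: compact_closedI => //; exact: closed_preimage.
apply/seteqP; split=> [x [[z [Kz Cqz] zx] pKx]|x [Cfx [z Kz zx]]].
  split=> //; suff : C (f x) by [].
  by rewrite -(fP _ _ Kz zx).
split; last by exists z.
exists z => //; split=> //; suff : C (q z) by [].
by rewrite (fP _ _ Kz zx).
Qed.

Lemma quotient_homeomorphic {Z X Y : topologicalType} (K : set Z) (p : Z -> X)
    (q : Z -> Y) :
  hausdorff_space X -> hausdorff_space Y -> compact K -> K !=set0 ->
  continuous p -> continuous q ->
  (forall z z', K z -> K z' -> p z = p z' <-> q z = q z') ->
  homeomorphic (p @` K) (q @` K).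
Proof.
move=> hX hY cK K0 cp cq pq.
have [f cf fpq] := quotient_factor hX cK K0 cp cq
  (fun z z' Kz Kz' => (pq z z' Kz Kz').1).
have [g cg gqp] := quotient_factor hY cK K0 cq cp
  (fun z z' Kz Kz' => (pq z z' Kz Kz').2).
exists f, g; split=> // _ [z Kz <-].
  by rewrite fpq // gqp //; split=> //; exists z.
by rewrite gqp // fpq //; split=> //; exists z.
Qed.

Lemma cantor_real_continuous {R : realType} :
  continuous (@cantor_real R : cantor_space -> R).
Proof.
apply: cantor_continuousP => a e e0.
have [n ne] : exists n : nat, 3 ^- n < e.
  have : (3^-1 : R) ^+ n @[n --> \oo] --> (0 : R).
    by apply: cvg_expr; rewrite ger0_norm; lra.
  move/cvgrPdist_lt => /(_ _ e0) [n _ /(_ _ (leqnn _)) /=].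
  rewrite sub0r normrN ger0_norm ?exprn_ge0 ?invr_ge0 // exprVn => ne.
  by exists n.
exists n => b ab; rewrite /ball /=.
by apply: le_lt_trans ne; exact: cantor_real_dist.
Qed.

Section FanOverCantorSet.
Context {R : realType} (T : pseudoMetricType R) (v : T) (le : T -> T -> Prop).
Hypothesis ord : lelek_order v le.
Variable g : (nat -> bool) -> T.
Hypothesis cg : cantor_continuous g.
Hypothesis ginj : injective g.
Hypothesis gmax : forall a, maximal_elt le (g a).

Lemma maximal_above_unique x m m' : x <> v -> maximal_elt le m ->
  maximal_elt le m' -> le x m -> le x m' -> m = m'.
Proof.
move=> xv mm mm' xm xm'; have [mm''|mm''] := lo_fork ord xv xm xm'.
  by apply/esym; exact: mm.
exact: mm'.
Qed.

(** Both fans are quotients of the compact set [K] of pairs [(x, a)] with [x] below [g a]: one by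
    [fst], the other by [std], whose level [h] is the height of [x] divided by that of [g a]. Both
    maps identify exactly the pairs over [v]. The map [i] carries the result from the subtype to the
    ambient space. *)
Lemma fan_over_cantor_set (X : topologicalType) (i : T -> X) :
  hausdorff_space X -> continuous i -> injective i ->
  homeomorphic (i @` [set x | exists a, le x (g a)]) (@std_cantor_fan R).
Proof.
move=> hX ci iinj.
have [q q_dense] := compact_dense_seq v (lo_compact ord).
pose mu := height v le q.
have mu_cont : continuous mu by exact: height_continuous.
have mu0 : mu v = 0 := height_min v le q.
have mug a : 0 < mu (g a).
  exact/(height_gt0 ord q_dense)/(maximal_neq_min ord)/gmax.
pose K : set (T * cantor_space) := [set z | le z.1 (g z.2)].
pose h (z : T * cantor_space) : R := mu z.1 / mu (g z.2).
pose std (z : T * cantor_space) : R * R :=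
  ((1 - h z) * 2^-1 + h z * cantor_real (z.2 : nat -> bool), h z).
have cgT : continuous (g : cantor_space -> T) := cantor_continuousP cg.
have cfst : continuous (fst : T * cantor_space -> T) by move=> z; exact: cvg_fst.
have csnd : continuous (snd : T * cantor_space -> cantor_space).
  by move=> z; exact: cvg_snd.
have cgs : continuous ((g : cantor_space -> T) \o (snd : T * cantor_space -> cantor_space)).
  by move=> z; apply: continuous_comp; [exact: csnd|exact: cgT].
have K_compact : compact K.
  apply: (subclosed_compact _ (compact_setX (lo_compact ord) cantor_space_compact)) => //.
  have -> : K = (fun z : T * cantor_space => (z.1, g z.2)) @^-1`
      [set p : T * T | le p.1 p.2] by [].
  apply: closed_preimage; last exact: (le_graph_closed ord).
  by apply: (continuous_pair cfst); exact: cgs.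
have h_cont : continuous h.
  move=> z; apply: cvgM.
    by apply: (continuous_comp (cfst z)); exact: mu_cont.
  apply: cvgV; first by rewrite gt_eqF.
  by apply: (continuous_comp (cgs z)); exact: mu_cont.
have std_cont : continuous std.
  apply: continuous_pair => // z; apply: cvgD.
    apply: cvgM; last exact: cvg_cst.
    by apply: cvgB; [exact: cvg_cst|exact: h_cont].
  apply: cvgM; first exact: h_cont.
  by apply: (continuous_comp (csnd z)); exact: cantor_real_continuous.
have h01 z : K z -> 0 <= h z <= 1.
  case: z => x a /= xa; apply/andP; split.
    rewrite divr_ge0 ?(ltW (mug a)) // -mu0.
    exact/(height_le ord q_dense)/(lo_min ord).
  by rewrite ler_pdivrMr // mul1r; exact: (height_le ord q_dense).
have h0 x a : (h (x, a) == 0) = (mu x == 0).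
  by rewrite mulf_eq0 invr_eq0 (gt_eqF (mug a)) orbF.
have mu_eq0 x : mu x = 0 -> x = v.
  move=> mux; apply: contrapT => /(height_gt0 ord q_dense).
  by rewrite -/mu mux ltxx.
have stdE : std @` K = @std_cantor_fan R.
  apply/seteqP; split=> [_ [[x a] Kz <-]|_ [c [t [+ [t01 ->]]]]].
    exists (cantor_real a), (h (x, a)); split; last by split; first exact: h01.
    by rewrite cantor_middle_thirdE; exists a.
  rewrite cantor_middle_thirdE => -[a _ <-].
  have [|x xa mux] := between_height ord (q := q) (x := g a) (t := t * mu (g a)).
    case/andP: t01 => t0 t1; rewrite mulr_ge0 ?(ltW (mug a)) //=.
    by rewrite ler_piMl // ltW.
  exists (x, a) => //; rewrite /std /h /= /mu mux mulfK //.
  by rewrite gt_eqF // mug.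
have <- : (i \o fst) @` K = i @` [set x | exists a, le x (g a)].
  apply/seteqP; split=> [_ [[x a] /= xa <-]|_ [x [a xa] <-]].
    by exists x => //; exists a.
  by exists (x, a).
rewrite -stdE; apply: quotient_homeomorphic => //.
- by exists (g (fun=> false), (fun=> false)); exact: (lo_refl ord).
- move=> z; apply: continuous_comp; [exact: cfst|exact: ci].
- move=> [x a] [x' a'] Kx Kx'; split => /=.
    move=> /iinj xx'; have [xv|xv] := pselect (x = v).
      have hv b : h (v, b) = 0 by apply/eqP; rewrite h0 mu0.
      by rewrite -xx' xv /std !hv /= !mul0r.
    rewrite -xx' in Kx' *.
    by rewrite (ginj (maximal_above_unique xv (@gmax a) (@gmax a') Kx Kx')).
  (* Level 0 means that both points are [v]. Otherwise the first coordinate can be divided by [t],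
     so the bits agree and both points lie on one leg, where the height is injective. *)
  rewrite /std => -[]; set t := h (x, a) => + tt'; rewrite -tt' => /addrI.
  have [t0|t0] := eqVneq t 0.
    move=> _; have -> : x = v by apply/mu_eq0/eqP; rewrite -(h0 x a) -/t t0.
    by rewrite (_ : x' = v) //; apply/mu_eq0/eqP; rewrite -(h0 x' a') -tt' t0.
  move=> /(mulfI t0) /cantor_real_inj aa'; congr i.
  move: tt'; rewrite /t /h /= -aa' => /(mulIf (invr_neq0 (lt0r_neq0 (mug a)))).
  move=> mxx'; rewrite -aa' /= in Kx'.
  have [xx'|x'x] := lo_chain ord Kx Kx'; apply: contrapT => ne.
    by have := height_lt ord q_dense xx' ne; rewrite -/mu mxx' ltxx.
  by have := height_lt ord q_dense x'x (nesym ne); rewrite -/mu mxx' ltxx.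
Qed.

End FanOverCantorSet.

(** * Arcs and segments *)

Lemma within_continuous_comp_within {X Y Z : topologicalType} (A : set X) (B : set Y)
    (f : X -> Y) (g : Y -> Z) :
  {within A, continuous f} -> {within B, continuous g} -> f @` A `<=` B ->
  {within A, continuous (g \o f)}.
Proof.
move=> /subspace_continuousP cf /subspace_continuousP cg fAB.
apply/subspace_continuousP => x Ax.
have Bfx : B (f x) by apply: fAB; exists x.
move=> P /(cg _ Bfx) /(cf _ Ax) /= h.
have {}h : nbhs x [set y | A y -> B (f y) -> P (g (f y))] by exact: h.
change (nbhs x [set y | A y -> P (g (f y))]).
apply: filterS h => y h Ay; apply: h => //.
by apply: fAB; exists y.
Qed.

Section Arcs.
Context {R : realType} (X : pseudoMetricType R).
Implicit Types (A B C : set X) (a b x y : X) (f : R -> X) (g : X -> R).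

Lemma homeo_image A f g : homeo_sets (`[0, 1] : set R) A f g -> A = f @` `[0, 1].
Proof.
move=> [_ _ fg gf]; apply/seteqP; split=> [x Ax|_ [t t01 <-]]; last exact: (fg t t01).1.
by have [gx fgx] := gf x Ax; exists (g x).
Qed.

Lemma arc_compact A a b : arc_ends A a b -> compact A.
Proof.
move=> [f [g [h _]]]; rewrite (homeo_image h); have [cf _ _ _] := h.
by apply: continuous_compact => //; exact: segment_compact.
Qed.

Lemma arc_is_connected A a b : arc_ends A a b -> connected A.
Proof.
move=> [f [g [h _]]]; rewrite (homeo_image h); have [cf _ _ _] := h.
by apply: connected_continuous_connected => //; exact: segment_connected.
Qed.

Let in01_0 : (`[0, 1]%classic : set R) 0. Proof. by rewrite /= in_itv /= lexx ler01. Qed.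
Let in01_1 : (`[0, 1]%classic : set R) 1. Proof. by rewrite /= in_itv /= lexx ler01. Qed.

Lemma arc_mem A a b : arc_ends A a b -> A a /\ A b.
Proof.
move=> [f [g [[_ _ fg _] [<- <-]]]].
by split; [exact: (fg _ in01_0).1|exact: (fg _ in01_1).1].
Qed.

Lemma arc_neq A a b : arc_ends A a b -> a <> b.
Proof.
move=> [f [g [[_ _ fg _] [<- <-]]]] /(congr1 g).
by rewrite (fg _ in01_0).2 (fg _ in01_1).2 => /eqP; rewrite eq_sym oner_eq0.
Qed.

Lemma subarc A f g s t : homeo_sets (`[0, 1] : set R) A f g ->
  0 <= s -> s < t -> t <= 1 -> arc_ends (f @` `[s, t]) (f s) (f t).
Proof.
move=> [cf cg fg gf] s0 st t1.
have ts0 : t - s != 0 by rewrite subr_eq0 gt_eqF.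
have ts_gt0 : 0 < t - s by rewrite subr_gt0.
pose l u : R := s + u * (t - s).
have lK u : (l u - s) / (t - s) = u by rewrite /l addrC addKr mulfK.
have Kl w : l ((w - s) / (t - s)) = w by rewrite /l divfK // addrC subrK.
have l_itv u : u \in `[0, 1] -> l u \in `[s, t].
  rewrite !in_itv /= /l => /andP[u0 u1].
  by rewrite lerDl mulr_ge0 ?(ltW ts_gt0) // -lerBrDl ler_piMl // ltW.
have l_itv' w : w \in `[s, t] -> (w - s) / (t - s) \in `[0, 1].
  rewrite !in_itv /= => /andP[sw wt].
  by rewrite divr_ge0 ?subr_ge0 ?(ltW st) //= ler_pdivrMr // mul1r lerD2r.
have st01 w : w \in `[s, t] -> (`[0, 1]%classic : set R) w.
  by rewrite /= !in_itv /= => /andP[sw wt]; rewrite (le_trans s0 sw) (le_trans wt).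
exists (f \o l), (fun x => (g x - s) / (t - s)); split; last first.
  by rewrite /= /l mul0r addr0 mul1r addrC subrK.
split.
- apply: (@within_continuous_comp_within R R X `[0, 1] `[0, 1] l f) => //.
    apply: continuous_subspaceT => u; apply: cvgD; first exact: cvg_cst.
    by apply: cvgM; [exact: cvg_id|exact: cvg_cst].
  by move=> _ [u u01 <-]; exact/st01/l_itv.
- apply: (@within_continuous_comp_within X R R _ setT g (fun w => (w - s) / (t - s))) => //.
    apply: continuous_subspaceW cg => _ [w wst <-].
    exact: (fg _ (st01 _ wst)).1.
  apply: continuous_subspaceT => u; apply: cvgM; last exact: cvg_cst.
  by apply: cvgB; [exact: cvg_id|exact: cvg_cst].
- move=> u u01 /=; split; first by exists (l u) => //; exact: l_itv.
  by rewrite (fg _ (st01 _ (l_itv _ u01))).2 lK.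
- move=> _ [w wst <-] /=; rewrite (fg _ (st01 _ wst)).2 Kl.
  by split=> //; exact: l_itv'.
Qed.

Lemma arc_sym A a b : arc_ends A a b -> arc_ends A b a.
Proof.
move=> [f [g [[cf cg fg gf] [fa fb]]]].
have r01 (u : R) : u \in `[0, 1] -> 1 - u \in `[0, 1].
  by rewrite !in_itv /= subr_ge0 => /andP[u0 u1]; rewrite u1 lerBlDr lerDl.
have rc : continuous (fun u : R => 1 - u).
  by move=> u; apply: cvgB; [exact: cvg_cst|exact: cvg_id].
exists (f \o (fun u => 1 - u)), ((fun u => 1 - u) \o g); split; last first.
  by rewrite /= subr0 subrr.
split.
- apply: (@within_continuous_comp_within R R X `[0, 1] `[0, 1]
    (fun u => 1 - u) f) => //.
    exact: continuous_subspaceT.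
  by move=> _ [u u01 <-]; exact: r01.
- apply: (@within_continuous_comp_within X R R _ setT g (fun u => 1 - u)) => //.
  exact: continuous_subspaceT.
- move=> u u01 /=; have [Af ->] := fg _ (r01 _ u01).
  by rewrite subKr.
- move=> x Ax /=; have [gx fgx] := gf _ Ax.
  by rewrite subKr; split=> //; exact: r01.
Qed.

(** The inverse parametrization maps [C] onto an interval containing [s] and [t]. *)
Lemma connected_in_arc A f g C s t : homeo_sets (`[0, 1] : set R) A f g ->
  C `<=` A -> connected C -> C (f s) -> C (f t) -> 0 <= s -> t <= 1 ->
  f @` `[s, t] `<=` C.
Proof.
move=> [cf cg fg gf] CA cC Cs Ct s0 t1 _ [u ust <-].
have /andP[su ut] : s <= u <= t by move: ust; rewrite /= in_itv.
have s01 : (`[0, 1]%classic : set R) s by rewrite /= in_itv /= s0 (le_trans su) // (le_trans ut).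
have t01 : (`[0, 1]%classic : set R) t by rewrite /= in_itv /= t1 (le_trans s0) // (le_trans su).
have : connected (g @` C).
  apply: connected_continuous_connected => //.
  exact: continuous_subspaceW cg.
move/connected_intervalP => /(_ s t).
case/(_ _ _ u (introT andP (conj su ut))).
- by exists (f s) => //; exact: (fg _ s01).2.
- by exists (f t) => //; exact: (fg _ t01).2.
- by move=> x Cx <-; rewrite (gf _ (CA _ Cx)).2.
Qed.

Lemma connected_in_arc_full A C a b : arc_ends A a b ->
  C `<=` A -> connected C -> C a -> C b -> C = A.
Proof.
move=> [f [g [h [fa fb]]]] CA cC Ca Cb; apply/seteqP; split=> //.
rewrite (homeo_image h); apply: (connected_in_arc h) => //; by rewrite ?fa ?fb.
Qed.

End Arcs.

(** * Arcs from the top of a fan, and the order they define *)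

Section FanSegments.
Context {R : realType} (X : pseudoMetricType R) (hX : hausdorff_space X).
Variables (L : set X) (v : X).
Hypothesis fanL : fan_with_top L v.
Implicit Types (A B : set X) (x y z : X).

(** The union over all candidate arcs avoids a choice; by [arc_unique] there is only one of them for
    [x] in [L]. *)
Definition seg x : set X := [set y | exists2 A, arc_in_from L v x A & A y].

Let Lv : L v. Proof. by have [_ []] := fanL. Qed.

(** Hereditary unicoherence makes the intersection connected; as it contains both ends, it is all of
    either arc. *)
Lemma arc_unique A B a b : A `<=` L -> B `<=` L ->
  arc_ends A a b -> arc_ends B a b -> A = B.
Proof.
move=> AL BL Aab Bab.
have cont C : arc_ends C a b -> continuum C.
  move=> Cab; split; [|exact: arc_compact Cab|exact: arc_is_connected Cab].
  by exists a; exact: (arc_mem Cab).1.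
have [[[_ _ hu] _] _] := fanL.
have cAB := hu A B AL BL (cont _ Aab) (cont _ Bab).
have [Aa Ab] := arc_mem Aab; have [Ba Bb] := arc_mem Bab.
transitivity (A `&` B); [symmetry|];
  by apply: connected_in_arc_full; [eassumption| | | |] => // ? [].
Qed.

Lemma segE x A : arc_in_from L v x A -> seg x = A.
Proof.
move=> xA; apply/seteqP; split=> [y [B xB By]|y Ay]; last by exists A.
suff <- : B = A by [].
case: xA xB => [[-> ->]|[AL Avx]] [[xv ->//]|[BL Bvx]].
- by have /(_ erefl) := arc_neq Bvx.
- by rewrite xv in Avx; have /(_ erefl) := arc_neq Avx.
- exact: arc_unique Bvx Avx.
Qed.

Lemma seg_arc x : L x -> arc_in_from L v x (seg x).
Proof.
move=> Lx; have [A xA] : exists A, arc_in_from L v x A.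
  have [->|xv] := pselect (x = v); first by exists [set v]; left.
  have [[[_ awc _] _] _] := fanL.
  have [A [AL Avx]] := awc _ _ Lv Lx (nesym xv).
  by exists A; right.
by rewrite (segE xA).
Qed.

Lemma seg_sub x : L x -> seg x `<=` L.
Proof. by move=> /seg_arc[[_ ->] _ ->|[]]. Qed.

Lemma seg_min x : L x -> seg x v.
Proof. by move=> /seg_arc[[_ ->]//|[_ h]]; have [] := arc_mem h. Qed.

Lemma seg_self x : L x -> seg x x.
Proof. by move=> /seg_arc[[-> ->]//|[_ h]]; have [] := arc_mem h. Qed.

Lemma seg_top : seg v = [set v].
Proof. by apply: segE; left. Qed.

Lemma seg_continuum x : L x -> continuum (seg x).
Proof.
move=> Lx; split; first by exists v; exact: seg_min.
  case: (seg_arc Lx) => [[_ ->]|[_ h]]; [|exact: arc_compact h]; exact: compact_set1.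
case: (seg_arc Lx) => [[_ ->]|[_ h]]; [|exact: arc_is_connected h]; exact: connected1.
Qed.

(** Initial pieces of the arc are again arcs from [v], so below [x] the order of the fan is the
    order of the parameters. *)
Lemma seg_param x : L x -> x <> v -> exists f g,
  [/\ homeo_sets (`[0, 1] : set R) (seg x) f g, f 0 = v, f 1 = x &
      forall t, 0 <= t <= 1 -> seg (f t) = f @` `[0, t]].
Proof.
move=> Lx xv; case: (seg_arc Lx) => [[]//|[sL [f [g [h [f0 f1]]]]]].
exists f, g; split=> // t /andP[]; rewrite le_eqVlt => /predU1P[<- _|t0 t1].
  by rewrite f0 seg_top set_itv1 image_set1 f0.
apply: segE; right; split; last by rewrite -f0; exact: subarc h _ _ _.
apply: subset_trans sL; rewrite (homeo_image h) => _ [u u0t <-]; exists u => //.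
move: u0t; rewrite /= !in_itv /= => /andP[-> ut]; exact: le_trans t1.
Qed.

Lemma seg_trans x y z : L z -> seg z y -> seg y x -> seg z x.
Proof.
move=> Lz; have [->|zv] := pselect (z = v); first by rewrite seg_top => ->; rewrite seg_top.
have [f [g [h f0 f1 segf]]] := seg_param Lz zv.
rewrite {1}(homeo_image h) => -[t t01 <-]; rewrite segf; last by move: t01; rewrite /= in_itv.
move=> [u u0t <-]; rewrite (homeo_image h); exists u => //.
move: u0t t01; rewrite /= !in_itv /= => /andP[-> ut] /andP[_]; exact: le_trans.
Qed.

Lemma homeo_inj A f g s t : homeo_sets (`[0, 1] : set R) A f g ->
  0 <= s <= 1 -> 0 <= t <= 1 -> f s = f t -> s = t.
Proof.
move=> [_ _ fg _] s01 t01 fst.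
have [_ <-] : A (f s) /\ g (f s) = s by apply: fg; rewrite /= in_itv.
have [_ <-] : A (f t) /\ g (f t) = t by apply: fg; rewrite /= in_itv.
by rewrite fst.
Qed.

Lemma seg_anti x y : L x -> seg y x -> seg x y -> x = y.
Proof.
move=> Lx yx xy; have [xv|xv] := pselect (x = v).
  by move: xy; rewrite xv seg_top => ->.
have [f [g [h f0 f1 segf]]] := seg_param Lx xv.
move: xy yx; rewrite (homeo_image h) => -[t t01 <-].
have {}t01 : 0 <= t <= 1 by move: t01; rewrite /= in_itv.
rewrite segf // => -[u]; rewrite /= in_itv /= => /andP[u0 ut] fux.
have /andP[t0 t1] := t01.
suff -> : t = 1 by rewrite f1.
apply/eqP; rewrite eq_le t1 /=.
suff <- : u = 1 by [].
apply: (homeo_inj h); rewrite ?u0 ?(le_trans ut) ?ler01 ?lexx //.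
by rewrite f1.
Qed.

Lemma seg_chain x y z : L z -> seg z x -> seg z y -> seg y x \/ seg x y.
Proof.
move=> Lz; have [->|zv] := pselect (z = v).
  by rewrite seg_top => -> ->; left; exact: seg_self.
have [f [g [h f0 f1 segf]]] := seg_param Lz zv.
rewrite (homeo_image h) => -[s s01 <-] [t t01 <-].
move: s01 t01; rewrite /= !in_itv /= => s01 t01; rewrite !segf //.
have /andP[s0 _] := s01; have /andP[t0 _] := t01.
have [st|/ltW ts] := lerP s t; [left; exists s|right; exists t] => //;
  by rewrite /= in_itv /= ?s0 ?t0.
Qed.

Let split_arc A f g s : homeo_sets (`[0, 1] : set R) A f g -> 0 <= s <= 1 ->
  f @` `[0, s] `&` f @` `[s, 1] = [set f s].
Proof.
move=> h s01; have /andP[s0 s1] := s01; apply/seteqP; split=> [x|_ ->]; last first.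
  by split; exists s => //; rewrite /= in_itv /= ?s0 ?s1 lexx.
move=> [[u + ux] [w + wx]]; rewrite /= !in_itv /= => /andP[u0 us] /andP[sw w1].
have uw : u = w.
  apply: (homeo_inj h); rewrite ?u0 ?w1 ?(le_trans us) ?(le_trans s0) //.
  by rewrite ux wx.
rewrite -ux; suff -> : u = s by [].
by apply/eqP; rewrite eq_le us uw sw.
Qed.

(* Two incomparable points above [x] would branch at the last common point of
   their segments, which is not [v] since it lies above [x]. *)
Lemma seg_fork x y z : L y -> L z -> x <> v -> seg y x -> seg z x ->
  seg z y \/ seg y z.
Proof.
move=> Ly Lz xv yx zx; apply: contrapT => /not_orP[nzy nyz].
have yv : y <> v by move=> yv; move: yx; rewrite yv seg_top.
have zv : z <> v by move=> zv; move: zx; rewrite zv seg_top.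
have [f [g [h f0 f1 segf]]] := seg_param Ly yv.
have [f' [g' [h' f'0 f'1 segf']]] := seg_param Lz zv.
have [_ cg fg gf] := h; have [_ _ f'g' g'f'] := h'.
have cI : compact (seg y `&` seg z).
  apply: compact_closedI; first by case: (seg_continuum Ly).
  by apply: compact_closed => //; case: (seg_continuum Lz).
have [||p /set_mem[yp zp] pmax] := compact_EVT_max (f := g) _ cI.
- by exists x.
- by apply: continuous_subspaceW cg; exact: subIsetl.
have [gp01 fgp] := gf _ yp; have [g'p01 f'g'p] := g'f' _ zp.
rewrite /= !in_itv /= in gp01 g'p01.
have /andP[gp0 gp1] := gp01; have /andP[g'p0 g'p1] := g'p01.
have pv : p <> v.
  move=> pv; have [gx01 fgx] := gf _ yx; rewrite /= in_itv /= in gx01.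
  have gv : g p = 0.
    apply: (homeo_inj h) => //; first by rewrite lexx ler01.
    by rewrite fgp f0.
  have : g x <= g p by apply: pmax; exact/mem_set.
  rewrite gv => gx0; have /andP[gx0' _] := gx01.
  have : g x = 0 by apply/eqP; rewrite eq_le gx0.
  by move=> e; apply: xv; rewrite -fgx e f0.
have gp_gt0 : 0 < g p.
  by rewrite lt_neqAle gp0 andbT; apply/eqP => e; apply: pv; rewrite -fgp -e f0.
have gp_lt1 : g p < 1.
  rewrite lt_neqAle gp1 andbT; apply/eqP => e.
  by apply: nzy; rewrite -f1 -e fgp.
have g'p_lt1 : g' p < 1.
  rewrite lt_neqAle g'p1 andbT; apply/eqP => e.
  by apply: nyz; rewrite -f'1 -e f'g'p.
have segp : seg p = f @` `[0, g p] by rewrite -segf // fgp.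
have segp' : seg p = f' @` `[0, g' p] by rewrite -segf' // f'g'p.
(* The triod at [p] goes back to [v], on to [y] and on to [z]; a fan has no ramification point other
   than [v]. *)
suff rp : ramification_point L p.
  by have [[_ ram] [_ rv]] := fanL; exact: pv (ram _ _ rp rv).
have sub1 : f @` `[g p, 1] `<=` seg y.
  rewrite (homeo_image h) => _ [u + <-]; rewrite /= in_itv /= => /andP[pu u1].
  by exists u => //; rewrite /= in_itv /= u1 (le_trans gp0).
have sub2 : f' @` `[g' p, 1] `<=` seg z.
  rewrite (homeo_image h') => _ [u + <-]; rewrite /= in_itv /= => /andP[pu u1].
  by exists u => //; rewrite /= in_itv /= u1 (le_trans g'p0).
have Lp : L p := seg_sub Ly yp.
exists (seg p `|` f @` `[g p, 1] `|` f' @` `[g' p, 1]); split.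
  move=> w [[/(seg_sub Lp)//|/sub1/(seg_sub Ly)//]|/sub2/(seg_sub Lz)//].
exists (seg p), (f @` `[g p, 1]), (f' @` `[g' p, 1]), v, y, z; split=> //.
- by case: (seg_arc Lp) => [[]//|[_ h1]]; exact: arc_sym.
- by rewrite -{2}fgp -f1; exact: subarc h _ _ _.
- by rewrite -{2}f'g'p -f'1; exact: subarc h' _ _ _.
- split; first by rewrite segp (split_arc h) // fgp.
    by rewrite segp' (split_arc h') // f'g'p.
  apply/seteqP; split=> [w [wy wz]|_ ->]; last first.
    split; first by exists (g p) => //; rewrite /= in_itv /= lexx.
    by exists (g' p) => //; rewrite /= in_itv /= lexx.
  have : g w <= g p by apply: pmax; apply/mem_set; split; [exact: sub1|exact: sub2].
  case: wy => u; rewrite /= in_itv /= => /andP[pu u1] <-.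
  have [|_ ->] := fg u; first by rewrite /= in_itv /= u1 (le_trans gp0).
  move=> up; suff -> : u = g p by rewrite fgp.
  by apply/eqP; rewrite eq_le up.
Qed.

Lemma end_point_maximal e y : end_point L e -> e <> v -> L y -> seg y e -> y = e.
Proof.
move=> [Le eend] ev Ly ye; case: (seg_arc Ly) => [[_ sv]|[sL syv]].
  by move: ye; rewrite sv.
by have [] := eend _ _ _ sL syv ye.
Qed.

(** An arc from [a] to [b] meets the continuum formed by [seg a] and [seg b] in a connected set
    containing both ends, so it lies in that continuum. Thus [e] is below [a] or below [b], and
    maximality makes it equal to that end. *)
Lemma maximal_end_point e : L e -> (forall y, L y -> seg y e -> y = e) ->
  end_point L e.
Proof.
move=> Le emax; split=> // A a b AL Aab Ae.
have [Aa Ab] := arc_mem Aab.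
have La := AL _ Aa; have Lb := AL _ Ab.
have [sa0 sac sao] := seg_continuum La; have [sb0 sbc sbo] := seg_continuum Lb.
have cQ : continuum (seg a `|` seg b).
  split; first by exists a; left; exact: seg_self.
    exact: compactU.
  by apply: connectedU => //; exists v; split; exact: seg_min.
have cA : continuum A.
  split; [|exact: arc_compact Aab|exact: arc_is_connected Aab].
  by exists a.
have [[[_ _ hu] _] _] := fanL.
have cAQ : connected (A `&` (seg a `|` seg b)).
  by apply: hu => //; move=> w [/(seg_sub La)|/(seg_sub Lb)].
have AQ := connected_in_arc_full Aab (@subIsetl _ _ _) cAQ.
have : (A `&` (seg a `|` seg b)) e.
  by rewrite AQ //; split=> //; [left|right]; exact: seg_self.
by move=> [_ [/(emax _ La)|/(emax _ Lb)]] ->; [left|right].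
Qed.

(** A failure at the radii [1 / (n + 1)] would yield a sequence tending to [x] whose arcs do not
    converge to [seg x], against the sequential form of smoothness. *)
Lemma seg_smooth x e : smooth_fan L v -> L x -> 0 < e -> exists2 d : R, 0 < d &
  forall x', L x' -> ball x d x' ->
    seg x' `<=` eps_nbhd (seg x) e /\ seg x `<=` eps_nbhd (seg x') e.
Proof.
move=> [_ sm] Lx e0; apply: contrapT => nex.
have /choice[u uP] n : exists x', [/\ L x', ball x (n.+1%:R^-1 : R) x' &
    ~ (seg x' `<=` eps_nbhd (seg x) e /\ seg x `<=` eps_nbhd (seg x') e)].
  apply: contrapT => nex'; apply: nex; exists (n.+1%:R^-1); first by rewrite /= invr_gt0.
  move=> x' Lx' xx'; apply: contrapT => nS; apply: nex'; exists x'.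
  by split.
have ux : u @ \oo --> x.
  apply/cvg_ballP => d d0.
  have [k _ kP] := near_infty_natSinv_lt (PosNum d0).
  exists k => // n /= kn; have [_ un _] := uP n.
  by apply: le_ball un; apply/ltW/kP.
have [] := sm x u (seg \o u) (seg x) Lx _ ux _ _ e e0.
- by move=> n; have [] := uP n.
- by move=> n; apply: seg_arc; have [] := uP n.
- exact: seg_arc.
- by move=> N /(_ N (leqnn N)); have [] := uP N.
Qed.

End FanSegments.

(** * Lelek fans *)

Section SubtypeTopology.
Context {X : topologicalType} (L : set X).

Lemma set_val_continuous : continuous (set_val : L -> X).
Proof. exact: initial_continuous. Qed.

Lemma compact_set_type : compact L -> compact [set: L].
Proof.
move=> cL F FF _.
have FL : F (set_val @^-1` L).
  by apply: filterS (@filterT _ F _) => x _; exact: set_valP.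
have [p [Lp clp]] := cL (set_val @ F) _ FL; exists (SigSub (mem_set Lp)); split=> // A B FA.
move=> [_ [[C oC <-] Cp CB]].
have [||_ [[x Ax <-] Cx]] := clp (set_val @` A) C.
- suff : F (set_val @^-1` (set_val @` A)) by [].
  by apply: filterS FA => x Ax; exists x.
- exact: open_nbhs_nbhs.
- by exists x; split=> //; exact: CB.
Qed.

Lemma hausdorff_set_type : hausdorff_space X -> hausdorff_space L.
Proof.
move=> hX p q clpq; apply: val_inj; apply: hX => A B nA nB.
have [x [Ax Bx]] := clpq _ _ (set_val_continuous nA) (set_val_continuous nB).
by exists (set_val x).
Qed.

Lemma connected_set_type (A : set L) : connected (set_val @` A) -> connected A.
Proof.
move=> cA B [b Bb] [C [C' oC' CE] BC] [D cD BD].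
have [D' oD' DE] := closed_openC cD.
have img (E : set X) : B = A `&` (set_val @^-1` E) ->
    set_val @` B = set_val @` A `&` E.
  move=> ->; apply/seteqP; split=> [_ [x [Ax Ex] <-]|_ [[x Ax <-] Ex]].
    by split=> //; exists x.
  by exists x.
have BA : set_val @` B = set_val @` A.
  apply: cA; first by exists (set_val b); exists b.
    by exists C' => //; apply: img; rewrite BC -CE.
  exists (~` D'); first exact: open_closedC.
  by apply: img; rewrite BD -[D]setCK -DE.
apply/seteqP; split=> x; first by rewrite BC => -[].
move=> Ax; have : (set_val @` A) (set_val x) by exists x.
by rewrite -BA => -[y By /val_inj <-].
Qed.

End SubtypeTopology.

Section LelekFan.
Context {R : realType} (X : pseudoMetricType R) (hX : hausdorff_space X).
Variables (L : set X) (v : X).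
Hypothesis lelekL : lelek_fan L v.

Let sm : smooth_fan L v. Proof. by case: lelekL. Qed.
Let fanL : fan_with_top L v. Proof. by case: sm. Qed.
Let Lv : L v. Proof. by have [_ []] := fanL. Qed.
Let LP (x : L) : L (set_val x). Proof. exact: set_valP. Qed.

Definition fan_top : L := SigSub (mem_set Lv).
Definition fan_le (x y : L) : Prop := seg L v (set_val y) (set_val x).

Let lift x (Lx : L x) : L := SigSub (mem_set Lx).

Lemma fan_not_degenerate : exists2 y, L y & y <> v.
Proof.
have [_ [_ [S [SL [A1 [A2 [A3 [e1 [e2 [e3 [Ae _ _ _ SE]]]]]]]]]]] := fanL.
exists e1; last exact/nesym/(arc_neq Ae).
by apply: SL; rewrite SE; left; left; exact: (arc_mem Ae).2.
Qed.

Lemma fan_maximalP (m : L) :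
  maximal_elt fan_le m <-> end_point L (set_val m) /\ set_val m <> v.
Proof.
split=> [mm|[me mv] y my]; last first.
  by apply: val_inj; exact: (end_point_maximal fanL me mv (LP y) my).
split.
  apply: (maximal_end_point fanL) => // y Ly my.
  by have /(congr1 val) : lift Ly = m by exact: mm.
move=> mv; have [y Ly] := fan_not_degenerate; apply.
have /(congr1 val) : lift Ly = m.
  by apply: mm; rewrite /fan_le mv; exact: (seg_min fanL).
by rewrite -mv.
Qed.

Lemma fan_maximal_dense (x : L) e : 0 < e ->
  exists2 m, maximal_elt fan_le m & ball x e m.
Proof.
(* Removing [v] ensures that the end point found is a maximal element. When [x] is [v], the rest of
   the ball still meets [L]: otherwise the point [v] would be clopen in the connected set [L], which
   has other points. *)
move=> e0; pose O : set X := (ball (set_val x) e)° `\` [set v].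
have cv : closed [set v] by exact/accessible_closed_set1/hausdorff_accessible.
have oO : open O by apply: openI; [exact: open_interior|exact: closed_openC].
have xb : (ball (set_val x) e)° (set_val x) by exact: nbhsx_ballx.
have [y Ly Oy] : exists2 y, L y & O y.
  have [xv|xv] := pselect (set_val x = v); last by exists (set_val x).
  apply: contrapT => nex.
  have [[[[_ _ cL] _ _] _] _] := fanL.
  have vL : [set v] = L.
    apply: cL; first by exists v.
      exists (ball (set_val x) e)°; first exact: open_interior.
      apply/seteqP; split=> [_ ->|y [Ly By]]; first by split=> //; move: xb; rewrite xv.
      by apply: contrapT => yv; apply: nex; exists y.
    by exists [set v] => //; apply/seteqP; split=> [_ ->|y []].
  by have [y] := fan_not_degenerate; rewrite -vL.
have : closure (end_point L) y by have [_ ->] := lelekL.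
move=> /(_ O (open_nbhs_nbhs (conj oO Oy)))[m [mend [/interior_subset xm mv]]].
have [Lm _] := mend.
by exists (lift Lm) => //; apply/fan_maximalP.
Qed.

Lemma fan_lelek_order : lelek_order fan_top fan_le.
Proof.
have [[[[_ cL coL] _ _] _] _] := fanL.
have top_neq (x : L) : x <> fan_top -> set_val x <> v.
  by move=> xv e; apply: xv; exact: val_inj.
have val_down (x : L) : set_val @` [set y | fan_le y x] = seg L v (set_val x).
  apply/seteqP; split=> [_ [y yx <-]//|y yx].
  have Ly := seg_sub fanL (LP x) yx.
  by exists (lift Ly).
split.
- exact: compact_set_type.
- exact: hausdorff_set_type.
- by move=> x; exact: (seg_self fanL (LP x)).
- by move=> x y z xy yz; exact: (seg_trans fanL (LP z) yz xy).
- by move=> x y xy yx; apply: val_inj; exact: (seg_anti fanL (LP x) xy yx).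
- by move=> x; exact: (seg_min fanL (LP x)).
- by move=> x y z xz yz; exact: (seg_chain fanL (LP z) xz yz).
- move=> x y z /top_neq xv xy xz.
  by have [] := seg_fork hX fanL (LP y) (LP z) xv xy xz; [left|right].
- move=> x; apply: connected_set_type; rewrite val_down.
  by case: (seg_continuum fanL (LP x)).
- move=> x; apply: (@closed_preimage _ _ (set_val : L -> X) (seg L v (set_val x))).
    exact: set_val_continuous.
  by apply: compact_closed => //; case: (seg_continuum fanL (LP x)).
- move=> x e e0; have [d d0 dP] := seg_smooth fanL sm (LP x) e0.
  exists d => // x' xx'; have [s1 s2] := dP _ (LP x') xx'; split.
    move=> y' /s1[z zx zy'].
    by exists (lift (seg_sub fanL (LP x) zx)).
  move=> y /s2[z zx zy].
  by exists (lift (seg_sub fanL (LP x') zx)).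
- have [y Ly yv] := fan_not_degenerate.
  by exists (lift Ly) => /(congr1 val).
- exact: fan_maximal_dense.
Qed.

End LelekFan.

Lemma maximal_cantor_partition {R : realType} (T : pseudoMetricType R) (v : T) le :
  lelek_order v le -> exists G : T -> (nat -> bool) -> T,
  [/\ forall e, maximal_elt le e -> cantor_continuous (G e),
      forall e a, maximal_elt le e -> maximal_elt le (G e a),
      forall e e' a a', maximal_elt le e -> maximal_elt le e' ->
        G e a = G e' a' -> e = e' /\ a = a' &
      forall m, maximal_elt le m -> exists e a, maximal_elt le e /\ G e a = m].
Proof.
move=> ord; have [q q_dense] := compact_dense_seq v (lo_compact ord).
have cT := lo_compact ord; have hT := lo_hausdorff ord.
apply: cantor_partition => //; last exact: (open_not_maximal ord).
move=> W oW W0.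
have maxE := maximal_eltE ord q_dense.
have [|||g [cg ginj gP]] := cantor_set_in_Gdelta
  (U := fun n => ~` height_gap v le q n) cT hT _ _ _ oW W0.
- by move=> n; apply: closed_openC; exact: (height_gap_closed ord).
- move=> n O oO [x Ox].
  have [e /= e0 eO] : exists2 e : R, 0 < e & ball x e `<=` O.
    by apply/nbhs_ballP; exact: open_nbhs_nbhs.
  have [m mm xm] := lo_dense ord x e0.
  exists m; split; first exact: eO.
  by have := mm; rewrite maxE => /(_ n I).
- exact: (open_two_points ord).
- exists g; split=> // a; have [Wg gn] := gP a; split=> //.
  by rewrite maxE => n _.
Qed.

Theorem mainTheorem1 (R : realType) (X : pseudoMetricType R)
    (hX : hausdorff_space X) (L : set X) (v : X) :
  lelek_fan L v ->
  exists C : set X -> set X,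
    [/\ (forall A, legs L v A -> C A `<=` L /\ cantor_fan (C A)),
        (forall A1 A2, legs L v A1 -> legs L v A2 -> A1 <> A2 ->
           C A1 `&` C A2 = [set v]) &
        \bigcup_(A in legs L v) C A = L].
Proof.
move=> lelekL; have [[fanL _] _] := lelekL.
have ord := fan_lelek_order hX lelekL.
set le := @fan_le R X L v in ord; set top := fan_top lelekL in ord.
have [G [cG GM Ginj Gsurj]] := maximal_cantor_partition ord.
pose val_seg (e : L) := seg L v (set_val e).
have val_seg_inj : injective val_seg.
  move=> e e' ee'; apply: (lo_anti ord).
    by rewrite /le /fan_le -/(val_seg e') -ee'; exact: (lo_refl ord).
  by rewrite /le /fan_le -/(val_seg e) ee'; exact: (lo_refl ord).
have legsP A : legs L v A -> exists2 e, maximal_elt le e & A = val_seg e.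
  move=> [e [eend [AL Ave]]]; have [Le _] := eend.
  exists (SigSub (mem_set Le)).
    by apply/fan_maximalP => //; split=> //; exact/nesym/(arc_neq Ave).
  by apply/esym; apply: (segE fanL); right.
have legs_seg e : maximal_elt le e -> legs L v (val_seg e).
  move=> /(fan_maximalP lelekL)[eend ev]; exists (set_val e); split=> //.
  by case: (seg_arc fanL (set_valP e)) => [[]|].
pose fan e := set_val @` [set x | exists a, le x (G e a)].
(* [C] has to be defined on every set; [val_seg_inj] recovers the index [e] from the leg. *)
pose C A := [set x | exists2 e, A = val_seg e & fan e x].
have CE e : C (val_seg e) = fan e.
  by apply/seteqP; split=> [x [e' /val_seg_inj ->]|x]; [|exists e].
have fan_v e : fan e v.
  by exists top => //; exists (fun=> false); exact: (lo_min ord).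
exists C; split.
- move=> A /legsP[e em ->]; rewrite CE; split.
    by move=> _ [x _ <-]; exact: set_valP.
  apply: (fan_over_cantor_set ord (g := G e)) => //.
  + exact: cG.
  + by move=> a a' /Ginj[].
  + by move=> a; exact: GM.
  + exact: set_val_continuous.
- move=> A1 A2 /legsP[e1 e1m ->] /legsP[e2 e2m ->] ne; rewrite !CE.
  apply/seteqP; split=> [x [[y [a ya] yx] [y' [a' y'a'] y'x]]|_ ->]; last by split.
  have yy' : y' = y by apply: val_inj; exact: etrans y'x (esym yx).
  rewrite yy' in y'a'; rewrite -yx.
  (* A common point other than the top has a single maximal point above it, so the two pieces share
     that point and have the same index. *)
  have [->//|yv] := pselect (y = top).
  have Gaa' := maximal_above_unique ord yv (GM _ a e1m) (GM _ a' e2m) ya y'a'.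
  by have [ee' _] := Ginj _ _ _ _ e1m e2m Gaa'; rewrite ee' in ne.
- apply/seteqP; split=> [x [A /legsP[e em ->]]|x Lx].
    by rewrite CE => -[y _ <-]; exact: set_valP.
  have [q q_dense] := compact_dense_seq top (lo_compact ord).
  have [m mm xm] := below_maximal ord q_dense (SigSub (mem_set Lx)).
  have [e [a [em Gea]]] := Gsurj _ mm.
  exists (val_seg e); first exact: legs_seg.
  by rewrite CE; exists (SigSub (mem_set Lx)) => //; exists a; rewrite Gea.
Qed.
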